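(* Let $H$ be a Hilbert space, $\mathcal A=B(H)$ and let $T\in B^a(l^2(B(H)))$. Then: (a) $$\chi_0^*(T)\le\lambda_0(T)\le\sqrt{\|T\|I_0^*(T)}\le\sqrt{\|T\|\alpha_0^*(T)}\le\sqrt{2\|T\|\chi_0^*(T)}.$$ (b) For each $\mu\in\{\alpha,\chi,I\}$: $\mu_0^*(T)=0$ if and only if $\lambda_0(T)=0$, if and only if $T$ is a ''compact'' operator.
   Context: $B(H)$ is the algebra of all bounded operators on $H$. $l^2(\mathcal A)$ is the right $\mathcal A$-module of all sequences $x=(\xi_1,\xi_2,\dots)$ in $\mathcal A$ for which $\sum_{j}\xi_j^*\xi_j$ converges in norm, with $\mathcal A$-valued inner product $\langle x,y\rangle=\sum_j\xi_j^*\eta_j$ (for $y=(\eta_1,\eta_2,\dots)$), norm $\|x\|=\|\langle x,x\rangle\|^{1/2}$ and unit ball $B_1$. $B^a(l^2(\mathcal A))$ is the $C^*$-algebra of all bounded $\mathcal A$-linear operators on $l^2(\mathcal A)$ having an adjoint. An operator is ''compact'' if it belongs to the norm-closed linear span of the operators $x\mapsto z\langle y,x\rangle$, $y,z\in l^2(\mathcal A)$. A free finitely generated submodule $M\le l^2(\mathcal A)$ is a closed $\mathcal A$-submodule isomorphic, as a Hilbert $\mathcal A$-module, to $\mathcal A^n$ for some $n\in\mathbb N$. For a bounded set $E$, $\lambda(E)$ is the greatest lower bound of all $\eta>0$ for which there is a free finitely generated submodule $M\le l^2(\mathcal A)$ with $\sup_{x\in E}\inf_{y\in M}\|x-y\|<\eta$.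 Let $P$ be the set of all semi-norms $p_{\varphi,y}(x)=\sqrt{\sum_{j=1}^\infty|\varphi(\eta_j^*\xi_j)|^2}$, $x=(\xi_1,\xi_2,\dots)\in l^2(\mathcal A)$, where $\varphi\in\mathcal A_*$ is a normal state and $y=(\eta_1,\eta_2,\dots)$ is a sequence of elements of $\mathcal A$ with $\sup_{j\ge1}\varphi(\eta_j^*\eta_j)=1$. For a bounded set $E$ and $p\in P$: $[\alpha(E)](p)$ is the infimum of all $\varepsilon>0$ such that $E=\bigcup_{i=1}^nS_i$ for some finitely many sets $S_i$ with $p(x'-x'')<\varepsilon$ for all $x',x''\in S_i$; $[\chi(E)](p)$ is the infimum of all $\varepsilon>0$ such that $E\subseteq\bigcup_{i=1}^n\{z:p(z-x_i)<\varepsilon\}$ for some finitely many $x_1,\dots,x_n\in l^2(\mathcal A)$; $[I(E)](p)$ is the supremum of all $\varepsilon>0$ for which there is an infinite set $S\subseteq E$ with $p(x'-x'')\ge\varepsilon$ for all distinct $x',x''\in S$ (and $0$ if there is no such $\varepsilon$). For $\mu\in\{\alpha,\chi,I\}$, $\mu^*(E)=\sup_{p\in P}[\mu(E)](p)$. For $T\in B^a(l^2(\mathcal A))$, $\mu_0^*(T)=\mu^*(T(B_1))$ and $\lambda_0(T)=\lambda(T(B_1))$. *)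

(* Defs.v *)
From HB Require Import structures.
From mathcomp Require Import all_boot all_order all_algebra.
From mathcomp Require Import sesquilinear complex.
From mathcomp Require Import all_classical all_reals.
From mathcomp Require Import topology normedtype sequences.

Set Implicit Arguments.
Unset Strict Implicit.
Unset Printing Implicit Defensive.

Import Order.TTheory GRing.Theory Num.Theory.
Import numFieldNormedType.Exports.

Local Open Scope classical_set_scope.
Local Open Scope ring_scope.

(* [hdot] is linear in its first argument and conjugate-linear in the second. *)
HB.mixin Record isHilbert (R : realType) H of CompleteNormedModule R[i] H := {
  hdot : {dot H for @Num.conj R[i]};
  hdot_norm : forall x : H, `|x| ^+ 2 = hdot x x }.

#[short(type="hilbertType")]
HB.structure Definition Hilbert (R : realType) :=
  {H of CompleteNormedModule R[i] H & isHilbert R H}.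

(* Norms of complex normed spaces are [R[i]]-valued in the library; [rnorm] is
   the same norm as a real number. *)
Definition rnorm (R : realType) (V : normedModType R[i]) (x : V) : R :=
  complex.Re `|x|.

Section RealNorm.
Context {R : realType}.
Implicit Types V : normedModType R[i].

Lemma complexrD (x y : R) : ((x + y)%:C = x%:C + y%:C)%C.
Proof. exact: (rmorphD (real_complex R)). Qed.

Lemma complexrM (x y : R) : ((x * y)%:C = x%:C * y%:C)%C.
Proof. exact: (rmorphM (real_complex R)). Qed.

Lemma complexrV (x : R) : ((x^-1)%:C = x%:C^-1)%C.
Proof. exact: (fmorphV (real_complex R)). Qed.

Lemma rnormE V (x : V) : ((rnorm x)%:C)%C = `|x|.
Proof. by rewrite /rnorm RRe_real// ger0_real. Qed.

Lemma rnorm_ge0 V (x : V) : 0 <= rnorm x.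
Proof. by rewrite -lecR rnormE normr_ge0. Qed.

Lemma rnorm_gt0 V (x : V) : (0 < rnorm x) = (x != 0).
Proof. by rewrite -ltcR rnormE normr_gt0. Qed.

Lemma ler_rnormD V (x y : V) : rnorm (x + y) <= rnorm x + rnorm y.
Proof. by rewrite -lecR complexrD !rnormE ler_normD. Qed.

Lemma rnormZ V (a : R[i]^o) (x : V) : rnorm (a *: x) = rnorm a * rnorm x.
Proof.
by apply: complexI; rewrite complexrM !rnormE normrZ.
Qed.

Lemma rnorm0 V : rnorm (0 : V) = 0.
Proof. by rewrite /rnorm normr0. Qed.

Lemma rnorm0_eq0 V (x : V) : rnorm x = 0 -> x = 0.
Proof. by move=> x0; apply: normr0_eq0; rewrite -rnormE x0. Qed.

End RealNorm.

Section BoundedOperators.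
Context {R : realType} (H : hilbertType R).

Definition bop_pred : {pred H -> H} :=
  fun f => `[< linear f /\ exists M : R, forall x, rnorm (f x) <= M * rnorm x >].

Fact bop_submod_closed : submod_closed bop_pred.
Proof.
split.
  apply/asboolP; split=> [a x y|]; first by rewrite scaler0 addr0.
  by exists 0 => x; rewrite rnorm0 mul0r.
move=> a f g /asboolP[lf [M fM]] /asboolP[lg [N gN]]; apply/asboolP; split.
  move=> b x y; rewrite /= !fctE lf lg !scalerDr !scalerA mulrC.
  by rewrite addrACA.
exists (rnorm (a : R[i]^o) * M + N) => x; rewrite !fctE.
rewrite (le_trans (ler_rnormD _ _))// mulrDl lerD// rnormZ -mulrA.
by rewrite ler_wpM2l ?rnorm_ge0.
Qed.

HB.instance Definition _ :=
  GRing.isSubmodClosed.Build _ _ bop_pred bop_submod_closed.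

(* The algebra B(H). *)
Definition bop : Type := {f : H -> H | f \in bop_pred}.

HB.instance Definition _ := [isSub of bop for @sval _ _].
HB.instance Definition _ := [Choice of bop by <:].
HB.instance Definition _ := [SubChoice_isSubLmodule of bop by <:].

Definition bop_fun (a : bop) : H -> H := val a.
Coercion bop_fun : bop >-> Funclass.

Lemma bop_linear (a : bop) : linear a.
Proof. by case: a => f fP; have /asboolP[] := fP. Qed.

HB.instance Definition _ (a : bop) :=
  GRing.isLinear.Build R[i] H H _ a (@bop_linear a).

Lemma bop_bounded (a : bop) : exists M : R, forall x, rnorm (a x) <= M * rnorm x.
Proof. by case: a => f fP; have /asboolP[] := fP. Qed.

Lemma bopP (a b : bop) : a =1 b -> a = b.
Proof. by move=> ab; apply/val_inj/funext. Qed.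

Fact bop_one_subproof : (@id H : H -> H) \in bop_pred.
Proof. by apply/asboolP; split=> //; exists 1 => x; rewrite mul1r. Qed.

Fact bop_mul_subproof (a b : bop) : (a \o b : H -> H) \in bop_pred.
Proof.
apply/asboolP; split=> [c x y /=|]; first by rewrite !linearP.
have [M aM] := bop_bounded a; have [N bN] := bop_bounded b.
exists (`|M| * N) => x /=; rewrite (le_trans (aM _))// -mulrA.
rewrite (@le_trans _ _ (`|M| * rnorm (b x)))//.
  by rewrite ler_wpM2r ?rnorm_ge0// ler_norm.
by rewrite ler_wpM2l.
Qed.

Definition bop_one : bop := exist (fun f => f \in bop_pred) _ bop_one_subproof.
Definition bop_mul (a b : bop) : bop := exist (fun f => f \in bop_pred) _ (bop_mul_subproof a b).

Fact bop_mulA : associative bop_mul. Proof. by move=> a b c; apply: bopP. Qed.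
Fact bop_mul1r : left_id bop_one bop_mul. Proof. by move=> a; apply: bopP. Qed.
Fact bop_mulr1 : right_id bop_one bop_mul. Proof. by move=> a; apply: bopP. Qed.
Fact bop_mulDl : left_distributive bop_mul +%R.
Proof. by move=> a b c; apply: bopP. Qed.
Fact bop_mulDr : right_distributive bop_mul +%R.
Proof. by move=> a b c; apply: bopP => x; exact: linearD. Qed.

(* [pzRingType], since B(H) is the zero ring when H = 0. *)
HB.instance Definition _ := GRing.Zmodule_isPzRing.Build bop
  bop_mulA bop_mul1r bop_mulr1 bop_mulDl bop_mulDr.

Definition bop_norm (a : bop) : R :=
  sup [set rnorm (a x) | x in [set x | rnorm x <= 1]].

Fact bop_norm_has_sup (a : bop) :
  has_sup [set rnorm (a x) | x in [set x | rnorm x <= 1]].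
Proof.
have [M aM] := bop_bounded a; split.
  by exists (rnorm (a 0)), 0 => //=; rewrite rnorm0.
exists `|M| => _ [x /= x1 <-]; rewrite (le_trans (aM x))//.
rewrite (le_trans (ler_wpM2r (rnorm_ge0 x) (ler_norm M)))//.
by rewrite ler_piMr.
Qed.

Lemma bop_norm_le1 (a : bop) x : rnorm x <= 1 -> rnorm (a x) <= bop_norm a.
Proof.
by move=> x1; apply: ub_le_sup; [case: (bop_norm_has_sup a)|exists x].
Qed.

Lemma bop_norm_le (a : bop) (c : R) :
  (forall x, rnorm x <= 1 -> rnorm (a x) <= c) -> bop_norm a <= c.
Proof.
move=> ac; apply: ge_sup; first by case: (bop_norm_has_sup a).
by move=> _ [x /= x1 <-]; exact: ac.
Qed.

Fact bop_normD (a b : bop) : bop_norm (a + b) <= bop_norm a + bop_norm b.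
Proof.
apply: bop_norm_le => x x1; rewrite (le_trans (ler_rnormD _ _))//.
by rewrite lerD// bop_norm_le1.
Qed.

Fact bop_normZ_le (l : R[i]^o) (a : bop) :
  bop_norm (l *: a) <= rnorm l * bop_norm a.
Proof.
apply: bop_norm_le => x x1; rewrite [X in rnorm X](_ : _ = l *: a x)// rnormZ.
by rewrite ler_wpM2l ?bop_norm_le1 ?rnorm_ge0.
Qed.

Fact bop_normZ (l : R[i]^o) (a : bop) :
  bop_norm (l *: a) = rnorm l * bop_norm a.
Proof.
have [->|l0] := eqVneq l 0.
  rewrite scale0r rnorm0 mul0r; apply/eqP; rewrite eq_le; apply/andP; split.
    by apply: bop_norm_le => x _; rewrite [X in rnorm X](_ : _ = 0) ?rnorm0.
  apply: le_trans (@bop_norm_le1 0 0 _); first exact: rnorm_ge0.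
  by rewrite rnorm0.
apply/eqP; rewrite eq_le bop_normZ_le/=.
rewrite -ler_pdivlMl ?rnorm_gt0//; have := bop_normZ_le l^-1 (l *: a).
rewrite scalerA mulVf// scale1r; congr (_ <= _ * _).
by apply: complexI; rewrite complexrV !rnormE normfV.
Qed.

Fact bop_norm_eq0 (a : bop) : bop_norm a = 0 -> a = 0.
Proof.
move=> a0; apply: bopP => x; apply: rnorm0_eq0.
have [->|x0] := eqVneq x 0; first by rewrite linear0 rnorm0.
have nx : rnorm (`|x|^-1 *: x) <= 1.
  by rewrite -lecR rnormE normrZ normfV normr_id mulVf// normr_eq0.
have := bop_norm_le1 a nx; rewrite a0 linearZ/= rnormZ pmulr_rle0.
  by move=> ax; apply/eqP; rewrite eq_le ax rnorm_ge0.
by rewrite rnorm_gt0 invr_eq0 normr_eq0.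
Qed.

Definition bop_cnorm (a : bop) : R[i] := ((bop_norm a)%:C)%C.

Fact bop_cnormD (a b : bop) : bop_cnorm (a + b) <= bop_cnorm a + bop_cnorm b.
Proof. by rewrite /bop_cnorm -complexrD lecR bop_normD. Qed.

Fact bop_cnormZ (l : R[i]^o) (a : bop) : bop_cnorm (l *: a) = `|l| * bop_cnorm a.
Proof.
by rewrite /bop_cnorm bop_normZ complexrM rnormE.
Qed.

Fact bop_cnorm_eq0 (a : bop) : bop_cnorm a = 0 -> a = 0.
Proof. by move=> /complexI /bop_norm_eq0. Qed.

HB.instance Definition _ := Lmodule_isNormed.Build R[i] bop
  bop_cnormD bop_cnormZ bop_cnorm_eq0.

End BoundedOperators.

Section StandardModule.
Context {R : realType} {H : hilbertType R}.
Local Notation A := (bop H).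

(* The adjoint exists for every [a] by the Riesz theorem, so that the default
   value 0 is never used. *)
Definition bop_adj (a : A) : A :=
  xget 0 [set b : A | forall x y : H, hdot (a x) y = hdot x (b y)].

(* l^2(A) is represented as a set of sequences; convergence of the series is
   in the operator norm of [A]. *)
Definition l2 : set (nat -> A) :=
  [set x | cvgn (series (fun j => bop_adj (x j) * x j))].

Definition l2dot (x y : nat -> A) : A :=
  limn (series (fun j => bop_adj (x j) * y j)).

Definition l2norm (x : nat -> A) : R := Num.sqrt (rnorm (l2dot x x)).

Definition l2ball : set (nat -> A) := [set x | l2 x /\ l2norm x <= 1].

Definition rscale (I : Type) (x : I -> A) (a : A) : I -> A := fun i => x i * a.

(* Operators on l^2(A) are given by maps on all sequences, of which only the
   restriction to [l2] is relevant. *)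
Local Notation oper := ((nat -> A) -> nat -> A).

Definition opnorm (T : oper) : R := sup [set l2norm (T x) | x in l2ball].

Definition l2_adjoint (T S : oper) : Prop :=
  (forall y, l2 y -> l2 (S y)) /\
  (forall x y, l2 x -> l2 y -> l2dot (T x) y = l2dot x (S y)).

(* T belongs to B^a(l^2(A)). *)
Definition adjointable (T : oper) : Prop :=
  [/\ forall x, l2 x -> l2 (T x),
      forall x y, l2 x -> l2 y -> T (x + y) = T x + T y,
      forall x a, l2 x -> T (rscale x a) = rscale (T x) a,
      exists C : R, forall x, l2 x -> l2norm (T x) <= C * l2norm x &
      exists S : oper, l2_adjoint T S].

Definition rank_one (z y : nat -> A) : oper := fun x => rscale z (l2dot y x).

Definition finite_rank : set oper := [set F | exists (n : nat)
  (c : 'I_n -> R[i]) (z y : 'I_n -> nat -> A),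
  (forall i, l2 (z i) /\ l2 (y i)) /\
  F = \sum_(i < n) c i *: rank_one (z i) (y i)].

Definition compact_op (T : oper) : Prop :=
  forall e : R, 0 < e -> exists2 F, finite_rank F & opnorm (T - F) < e.

Definition submodule (M : set (nat -> A)) : Prop :=
  [/\ M `<=` l2, M 0, forall x y, M x -> M y -> M (x + y) &
      forall x a, M x -> M (rscale x a)].

Definition l2_closed (M : set (nat -> A)) : Prop := forall x, l2 x ->
  (forall e : R, 0 < e -> exists2 y, M y & l2norm (x - y) < e) -> M x.

(* Here A^n has the inner product \sum_i a_i^* b_i. *)
Definition hilbert_module_iso (n : nat) (M : set (nat -> A))
    (u : ('I_n -> A) -> nat -> A) : Prop :=
  [/\ set_bij setT M u,
      forall a b, u (a + b) = u a + u b,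
      forall a c, u (rscale a c) = rscale (u a) c &
      forall a b, l2dot (u a) (u b) = \sum_(i < n) bop_adj (a i) * b i].

Definition free_fg (M : set (nat -> A)) : Prop :=
  [/\ submodule M, l2_closed M &
      exists n (u : ('I_n -> A) -> nat -> A), hilbert_module_iso M u].

(* The library's [sup] and [inf] of a set of reals are 0 when the set is empty
   or unbounded.  The sets below are bounded whenever [E] is a bounded subset
   of [l2], and the empty ones are the index set of [istratescu], where the
   value 0 is intended, and [seminorms] when H = 0. *)
Definition lambda (E : set (nat -> A)) : R :=
  inf [set e | 0 < e /\ exists2 M, free_fg M &
    sup [set inf [set l2norm (x - y) | y in M] | x in E] < e].

(* The predual of B(H) consists of the functionals
   a |-> \sum_n <a xi_n, eta_n> with square-summable [xi] and [eta]. *)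
Definition predual : set {scalar A} := [set phi |
  exists xi eta : nat -> H,
    [/\ cvgn (series (fun n => rnorm (xi n) ^+ 2)),
        cvgn (series (fun n => rnorm (eta n) ^+ 2)) &
        forall a : A, series (fun n => hdot (a (xi n)) (eta n) : R[i]^o) @ \oo
          --> (phi a : R[i]^o)]].

Definition normal_state : set {scalar A} := [set phi |
  [/\ predual phi, forall a : A, 0 <= phi (bop_adj a * a) & phi 1 = 1]].

Definition seminorm (phi : {scalar A}) (y x : nat -> A) : R :=
  Num.sqrt (limn (series (fun j =>
    rnorm (phi (bop_adj (y j) * x j) : R[i]^o) ^+ 2))).

(* The set P; the numbers phi(eta_j^* eta_j) are real since phi is positive,
   and a supremum equal to 1 entails that they are bounded. *)
Definition seminorms : set ((nat -> A) -> R) := [set p |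
  exists phi y, [/\ normal_state phi,
    sup [set complex.Re (phi (bop_adj (y j) * y j)) | j in [set: nat]] = 1 &
    p = seminorm phi y]].

Local Notation measure := (set (nat -> A) -> ((nat -> A) -> R) -> R).

Definition kuratowski : measure := fun E p =>
  inf [set e | 0 < e /\ exists (n : nat) (S : 'I_n -> set (nat -> A)),
    E = \bigcup_i S i /\
    forall i x' x'', S i x' -> S i x'' -> p (x' - x'') < e].

Definition hausdorff : measure := fun E p =>
  inf [set e | 0 < e /\ exists (n : nat) (x : 'I_n -> nat -> A),
    (forall i, l2 (x i)) /\
    E `<=` \bigcup_i [set z | l2 z /\ p (z - x i) < e]].

Definition istratescu : measure := fun E p =>
  sup [set e | 0 < e /\ exists S : set (nat -> A),
    [/\ S `<=` E, infinite_set S &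
        forall x' x'', S x' -> S x'' -> x' <> x'' -> e <= p (x' - x'')]].

Definition star (mu : measure) (E : set (nat -> A)) : R :=
  sup [set mu E p | p in seminorms].

Definition star0 (mu : measure) (T : oper) : R := star mu (T @` l2ball).

Definition lambda0 (T : oper) : R := lambda (T @` l2ball).

End StandardModule.

(* Main.v *)
Require Import Defs.
From HB Require Import structures.
From mathcomp Require Import all_boot all_order all_algebra.
From mathcomp Require Import sesquilinear complex.
From mathcomp Require Import all_classical all_reals.
From mathcomp Require Import topology normedtype sequences.
From mathcomp Require Import ring lra.

Set Implicit Arguments.
Unset Strict Implicit.
Unset Printing Implicit Defensive.

Import Order.TTheory GRing.Theory Num.Theory.
Import numFieldNormedType.Exports.

Local Open Scope classical_set_scope.
Local Open Scope ring_scope.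

(** An element [x] of l^2(A) is studied through the vector sequences
    [j |-> x j h], with [h] in [H]: the norm of [x] is the supremum over unit
    vectors [h] of their l^2 norms, membership in l^2(A) is a Cauchy condition
    uniform in [h], and a tail of [x] is its distance to the free submodule of
    the sequences supported on the first [n] coordinates.

    - [chi <= lambda] ([hausdorff_le_lambda0]).  For a normal state, positivity
      and the Cauchy-Schwarz inequality give [p x <= |x|] ([seminorm_l2norm]),
      so that it is enough to see that a bounded part of a free finitely
      generated submodule [M] is totally bounded for [p].  Its elements are
      combinations of finitely many generators with bounded coefficients, hence
      have uniformly small tails, and what remains are finitely many bounded
      complex coordinates [phi (eta_j^* xi_j)]
      ([free_fg_totally_bounded]).

    - [lambda^2 <= |T| I] ([lambda0_le_istratescu]).  If [c < lambda], then for
      every [n] the tail of [T x] beyond [n] exceeds [c] for some [x] in the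
      ball, whence, with [S] the adjoint of [T], some [zeta n] of norm at most 1,
      finitely supported beyond [n], with [|S (zeta n)| >= c]
      ([tail_test_vector]).  The elements [w n = T S (zeta n) / |T|] belong to
      the image of the ball and pair with [zeta n] to
      [|S (zeta n)|^2 / |T| >= c^2 / |T|], whereas the pairing of [w k] with
      [zeta n] is small for [n] far beyond [k].  Thinning out makes the
      supports disjoint, and then one semi-norm, built from a vector state and
      the directions of the coordinates of all the [zeta]'s, separates the
      [w n] by almost [c^2 / |T|] ([separated_sequence]).  The detour through
      [T S] is what makes the components of the other [w k] along [zeta n]
      small; it also explains the square root in the estimate.

    - [I <= alpha <= 2 chi] holds for every bounded set: it is the pigeonhole
      principle and the triangle inequality.

    The four quantities thus vanish together.  When [I] vanishes, so do the
    uniform tails of [T] in the limit, which means that [T] is a norm limit of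
    its finite rank truncations ([compact_of_tails]); conversely the tails of a
    finite rank operator, hence of a compact one, tend to 0 uniformly on the
    ball ([compact_lambda0]). *)

Local Notation cabs z := (rnorm (z : _[i]^o)).

(** * Real estimates *)

Lemma epsilon_le (R : realFieldType) (x y : R) :
  (forall e, 0 < e -> x <= y + e) -> x <= y.
Proof. by move=> h; apply/ler_addgt0Pr. Qed.

Lemma ler_sqr_nneg (R : realFieldType) (x y : R) : 0 <= x -> x <= y -> x ^+ 2 <= y ^+ 2.
Proof. by move=> x0 xy; rewrite lerXn2r// nnegrE// (le_trans x0). Qed.

Section FiniteSums.
Context {R : realType}.

Lemma sum_CauchySchwarz (I : Type) (r : seq I) (f g : I -> R) :
  (\sum_(i <- r) f i * g i) ^+ 2 <=
  (\sum_(i <- r) f i ^+ 2) * (\sum_(i <- r) g i ^+ 2).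
Proof.
elim: r => [|i r IH]; first by rewrite !big_nil expr0n mul0r.
rewrite !big_cons; move: IH.
set s := \sum_(j <- r) _; set a := \sum_(j <- r) _; set b := \sum_(j <- r) _.
have a0 : 0 <= a by apply: sumr_ge0 => j _; exact: sqr_ge0.
have b0 : 0 <= b by apply: sumr_ge0 => j _; exact: sqr_ge0.
move=> sab; rewrite -subr_ge0.
have -> : (f i ^+ 2 + a) * (g i ^+ 2 + b) - (f i * g i + s) ^+ 2 =
  (a * b - s ^+ 2) + (f i ^+ 2 * b + g i ^+ 2 * a - f i * g i * s *+ 2) by ring.
rewrite addr_ge0 ?subr_ge0//.
have h : (f i * g i * s) ^+ 2 <= (f i ^+ 2 * b) * (g i ^+ 2 * a).
  rewrite exprMn [leRHS](_ : _ = (f i * g i) ^+ 2 * (a * b)); last by ring.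
  by rewrite ler_wpM2l// sqr_ge0.
have u0 : 0 <= f i ^+ 2 * b by rewrite mulr_ge0// sqr_ge0.
have v0 : 0 <= g i ^+ 2 * a by rewrite mulr_ge0// sqr_ge0.
move: h u0 v0; set u := f i ^+ 2 * b; set v := g i ^+ 2 * a.
set w := f i * g i * s => h u0 v0.
rewrite leNgt; apply/negP; rewrite -mulr_natl => uvw.
have := sqr_ge0 (u - v); nra.
Qed.

(** Assuming only domination by a sum lets the triangle inequalities of the
    module norm and of the semi-norms be instances. *)
Lemma sum_Minkowski (I : Type) (r : seq I) (f g k : I -> R) (a b : R) :
  (forall i, 0 <= k i <= f i + g i) -> 0 <= a -> 0 <= b ->
  \sum_(i <- r) f i ^+ 2 <= a ^+ 2 -> \sum_(i <- r) g i ^+ 2 <= b ^+ 2 ->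
  \sum_(i <- r) k i ^+ 2 <= (a + b) ^+ 2.
Proof.
move=> kfg a0 b0 fa gb.
have k2 : \sum_(i <- r) k i ^+ 2 <= \sum_(i <- r) (f i + g i) ^+ 2.
  apply: ler_sum => i _; have /andP[k0 kle] := kfg i.
  by rewrite lerXn2r// nnegrE// (le_trans k0).
apply: (le_trans k2).
have -> : \sum_(i <- r) (f i + g i) ^+ 2 = \sum_(i <- r) f i ^+ 2 +
    \sum_(i <- r) g i ^+ 2 + 2 * \sum_(i <- r) f i * g i.
  by rewrite mulr_sumr -!big_split; apply: eq_bigr => i _ /=; ring.
have := sum_CauchySchwarz r f g.
have f0 : 0 <= \sum_(i <- r) f i ^+ 2 by apply: sumr_ge0 => i _; exact: sqr_ge0.
have g0 : 0 <= \sum_(i <- r) g i ^+ 2 by apply: sumr_ge0 => i _; exact: sqr_ge0.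
move: fa gb f0 g0; set F := \sum_(i <- r) _; set G := \sum_(i <- r) _.
set s := \sum_(i <- r) _ => fa gb f0 g0 sFG.
have ab0 : 0 <= a * b by rewrite mulr_ge0.
have FG : F * G <= a ^+ 2 * b ^+ 2 by exact: ler_pM.
suff : s <= a * b by nra.
by rewrite leNgt; apply/negP => abs; nra.
Qed.

End FiniteSums.

(** * Complex numbers and sesquilinear forms *)

Section ComplexModulus.
Context {R : realType}.
Implicit Types z w : R[i].

Lemma cabs_sqr z : cabs z ^+ 2 = complex.Re z ^+ 2 + complex.Im z ^+ 2.
Proof.
by rewrite /rnorm normc_def/= sqr_sqrtr// addr_ge0// sqr_ge0.
Qed.

Lemma cabsM z w : cabs (z * w) = cabs z * cabs w.
Proof. exact: rnormZ. Qed.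

Lemma cabs_conj z : cabs z^* = cabs z.
Proof. by rewrite /rnorm norm_conjC. Qed.

Lemma cabs_ler_Re z : `|complex.Re z| <= cabs z.
Proof.
rewrite -(@ler_pXn2r _ 2)// ?nnegrE ?rnorm_ge0// cabs_sqr real_normK ?num_real//.
by rewrite lerDl sqr_ge0.
Qed.

Lemma Re_le_nm z : complex.Re z <= cabs z.
Proof. exact: le_trans (ler_norm _) (cabs_ler_Re z). Qed.

Lemma cabs_ler_Im z : `|complex.Im z| <= cabs z.
Proof.
rewrite -(@ler_pXn2r _ 2)// ?nnegrE ?rnorm_ge0// cabs_sqr.
by rewrite [X in X <= _]real_normK ?num_real// lerDr sqr_ge0.
Qed.

Lemma cabs_real (x : R) : cabs (x%:C)%C = `|x|.
Proof.
apply/eqP; rewrite -(@eqrXn2 _ 2)// ?rnorm_ge0// cabs_sqr/=.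
by rewrite expr0n addr0 real_normK ?num_real.
Qed.

Lemma ReD z w : complex.Re (z + w) = complex.Re z + complex.Re w.
Proof. by case: z w => [a b] [c d]. Qed.

Lemma ImD z w : complex.Im (z + w) = complex.Im z + complex.Im w.
Proof. by case: z w => [a b] [c d]. Qed.

Lemma ReN z : complex.Re (- z) = - complex.Re z.
Proof. by case: z. Qed.

Lemma Re_conj z : complex.Re z^* = complex.Re z.
Proof. by case: z. Qed.

Lemma ge0_complex z : 0 <= z -> z = ((complex.Re z)%:C)%C /\ 0 <= complex.Re z.
Proof.
case: z => a b; rewrite lecE/= => /andP[/eqP -> a0]; split=> //.
Qed.

Lemma Re_sum (I : Type) (r : seq I) (F : I -> R[i]) :
  complex.Re (\sum_(i <- r) F i) = \sum_(i <- r) complex.Re (F i).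
Proof. by elim/big_rec2: _ => //= i x y _ <-; rewrite ReD. Qed.

Lemma rnorm_sum (V : normedModType R[i]) (I : Type) (r : seq I) (F : I -> V) :
  rnorm (\sum_(i <- r) F i) <= \sum_(i <- r) rnorm (F i).
Proof.
elim/big_rec2: _ => [|i x y _ xy]; first by rewrite rnorm0.
by rewrite (le_trans (ler_rnormD _ _))// lerD2l.
Qed.

Lemma rnormN (V : normedModType R[i]) (x : V) : rnorm (- x) = rnorm x.
Proof. by rewrite /rnorm normrN. Qed.

Lemma rnormB (V : normedModType R[i]) (x y : V) : rnorm (x - y) = rnorm (y - x).
Proof. by rewrite -rnormN opprB. Qed.

Lemma rnorm_realZ (V : normedModType R[i]) (t : R) (x : V) :
  rnorm ((t%:C)%C *: x) = `|t| * rnorm x.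
Proof. by rewrite rnormZ cabs_real. Qed.

(** Over the complex numbers, nonnegativity on the diagonal forces hermitian
    symmetry by polarization.  The forms to which this applies are the inner
    product of [H] and the pairing [(a, b) |-> phi (b^* a)] of a positive
    functional. *)
Section SesquilinearForm.
Variables (V : lmodType R[i]) (B : V -> V -> R[i]).
Hypothesis Bl : forall a (u v w : V), B (a *: u + v) w = a * B u w + B v w.
Hypothesis Br : forall a (u v w : V), B w (a *: u + v) = a^* * B w u + B w v.
Hypothesis B_ge0 : forall u, 0 <= B u u.

Lemma sesqui_expand a u v : B (a *: u + v) (a *: u + v) =
  a * a^* * B u u + a * B u v + a^* * B v u + B v v.
Proof. by rewrite Bl !Br; ring. Qed.

Lemma sesqui_herm u v : B v u = (B u v)^*.
Proof.
have I z : 0 <= z -> complex.Im z = 0 by case: z => a b; rewrite lecE => /andP[/eqP].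
have := I _ (B_ge0 (1 *: u + v)); have := I _ (B_ge0 ('i%C *: u + v)).
rewrite !sesqui_expand; have := I _ (B_ge0 u); have := I _ (B_ge0 v).
move: (B u u) (B v v) (B u v) (B v u) => [a b] [c d] [e f] [g h] /=.
simpc => /= -> ->; rewrite !(mulr0, mulr1, mul0r, mul1r, subr0, add0r, addr0, oppr0).
move=> h1 h2; congr Complex; lra.
Qed.

Lemma sesqui_CauchySchwarz u v :
  cabs (B u v) ^+ 2 <= complex.Re (B u u) * complex.Re (B v v).
Proof.
have [vE v0] := ge0_complex (B_ge0 v); have [uE u0] := ge0_complex (B_ge0 u).
have quad (s : R) : 0 <= s ^+ 2 * cabs (B u v) ^+ 2 * complex.Re (B u u)
    - 2 * s * cabs (B u v) ^+ 2 + complex.Re (B v v).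
  have := B_ge0 ((- s%:C * (B u v)^*)%C *: u + v).
  rewrite sesqui_expand (sesqui_herm u v) uE vE !cabs_sqr /=.
  move: (B u v) (complex.Re (B u u)) (complex.Re (B v v)) => [e f] a c.
  rewrite lecE => /andP[_] /le_trans -> //=; rewrite le_eqVlt; apply/orP; left.
  by apply/eqP; simpc => /=; ring.
move: quad u0 v0; set n := cabs _ ^+ 2; set a := complex.Re _; set c := complex.Re _.
have n0 : 0 <= n by rewrite sqr_ge0.
move=> quad a0 c0; have [a_eq0|a_neq0] := eqVneq a 0.
  rewrite a_eq0 mul0r leNgt; apply/negP => n_gt0.
  have := quad ((c + 1) / (2 * n)); rewrite a_eq0 mulr0 add0r.
  have -> : 2 * ((c + 1) / (2 * n)) * n = c + 1 by field; rewrite gt_eqF.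
  lra.
have a_gt0 : 0 < a by rewrite lt_def a_neq0.
have := quad a^-1.
have -> : a^-1 ^+ 2 * n * a - 2 * a^-1 * n + c = (a * c - n) / a by field.
by rewrite pmulr_lge0 ?invr_gt0// subr_ge0.
Qed.

End SesquilinearForm.

End ComplexModulus.

Section SequentialConvergence.
Context {R : realType}.

(** Norms and radii of balls in a complex space are complex numbers; with real
    ones, linear arithmetic applies to the estimates. *)
Lemma cvg_rnormP (V : normedModType R[i]) (u : nat -> V) (l : V) :
  u @ \oo --> l <->
  forall e : R, 0 < e -> exists N, forall n, (N <= n)%N -> rnorm (u n - l) <= e.
Proof.
split=> [/cvgrPdist_lt ul e e0|ul].
  have /ul[N _ h] : 0 < (e%:C)%C :> R[i] by rewrite ltcR.
  by exists N => n /h /ltW; rewrite -rnormE lecR rnormB.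
apply/cvgrPdist_lt => e e0; have [eE e1] := ge0_complex (ltW e0).
have e2 : 0 < complex.Re e / 2.
  by rewrite divr_gt0// lt_def e1 andbT; apply: contraTneq e0 => h; rewrite eE h ltxx.
have [N h] := ul _ e2; exists N => // n /= /h.
rewrite -rnormB eE -rnormE ltcR => /le_lt_trans; apply; lra.
Qed.

Lemma cauchy_rnorm_cvg (V : completeNormedModType R[i]) (u : nat -> V) :
  (forall e : R, 0 < e ->
    exists N, forall m n, (N <= m)%N -> (N <= n)%N -> rnorm (u m - u n) <= e) ->
  cvgn u.
Proof.
move=> uC; apply/cauchy_cvgP; apply: cauchy_exP => e e0.
have [eE e1] := ge0_complex (ltW e0).
have e2 : 0 < complex.Re e / 2.
  by rewrite divr_gt0// lt_def e1 andbT; apply: contraTneq e0 => h; rewrite eE h ltxx.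
have [N h] := uC _ e2; exists (u N), N => // n /= Nn.
rewrite -ball_normE/= -rnormE eE ltcR.
by apply: le_lt_trans (h _ _ (leqnn _) Nn) _; lra.
Qed.

Lemma seq_cvg_unique (V : normedModType R[i]) (u : nat -> V) (x y : V) :
  u @ \oo --> x -> u @ \oo --> y -> x = y.
Proof. exact: (@norm_cvg_unique _ V (u @ \oo)). Qed.

Lemma rnorm_lim_le (V : normedModType R[i]) (u : nat -> V) (l : V) (c : R) N :
  u @ \oo --> l -> (forall n, (N <= n)%N -> rnorm (u n) <= c) -> rnorm l <= c.
Proof.
move=> /cvg_rnormP ul uc; apply: epsilon_le => e /ul[M h].
have := h _ (leq_maxr N M); have := uc _ (leq_maxl N M).
move: (u _) => x xc xl.
have -> : l = x + (l - x) by rewrite addrC subrK.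
by rewrite (le_trans (ler_rnormD _ _))// lerD// rnormB.
Qed.

(** Evaluation of operators at a vector, pairing with a vector, conjugation and
    bounded functionals are all of this kind. *)
Lemma cvg_lipschitz (V W : normedModType R[i]) (f : V -> W) (k : R)
    (u : nat -> V) (l : V) :
  (forall x y, rnorm (f x - f y) <= k * rnorm (x - y)) ->
  u @ \oo --> l -> (fun n => f (u n)) @ \oo --> f l.
Proof.
move=> fk /cvg_rnormP ul; apply/cvg_rnormP => e e0.
have k1 : 0 < `|k| + 1 by rewrite ltr_pwDr.
have [N h] := ul _ (divr_gt0 e0 k1); exists N => n /h {}h.
apply: (le_trans (fk _ _)); apply: (@le_trans _ _ ((`|k| + 1) * rnorm (u n - l))).
  by rewrite ler_wpM2r ?rnorm_ge0// (le_trans (ler_norm k))// lerDl.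
by rewrite mulrC -ler_pdivlMr.
Qed.

End SequentialConvergence.

(** * Hilbert space and its bounded operators *)

Section HilbertSpace.
Context {R : realType} {H : hilbertType R}.
Implicit Types (x y z : H) (a : R[i]).

Lemma hdotC x y : hdot y x = (hdot x y)^*.
Proof. by rewrite hermC /= mul1r. Qed.

Lemma hdotPl a x y z : hdot (a *: x + y) z = a * hdot x z + hdot y z.
Proof. by rewrite linearPl. Qed.

Lemma hdotPr a x y z : hdot z (a *: x + y) = a^* * hdot z x + hdot z y.
Proof. by rewrite linearPr. Qed.

Lemma hdotDl x y z : hdot (x + y) z = hdot x z + hdot y z.
Proof. by rewrite linearDl. Qed.

Lemma hdotDr x y z : hdot z (x + y) = hdot z x + hdot z y.
Proof. by rewrite linearDr. Qed.

Lemma hdotBl x y z : hdot (x - y) z = hdot x z - hdot y z.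
Proof. by rewrite linearBl. Qed.

Lemma hdotBr x y z : hdot z (x - y) = hdot z x - hdot z y.
Proof. by rewrite linearBr. Qed.

Lemma hdotNr x z : hdot z (- x) = - hdot z x.
Proof. by rewrite linearNr. Qed.

Lemma hdotZl a x z : hdot (a *: x) z = a * hdot x z.
Proof. by rewrite linearZl_LR. Qed.

Lemma hdotZr a x z : hdot z (a *: x) = a^* * hdot z x.
Proof. by rewrite linearZr_LR. Qed.

Lemma hdot0l z : hdot 0 z = 0.
Proof. by rewrite linear0l. Qed.

Lemma hdot0r z : hdot z 0 = 0.
Proof. by rewrite linear0r. Qed.

Lemma hdot_suml (I : Type) (r : seq I) (F : I -> H) z :
  hdot (\sum_(i <- r) F i) z = \sum_(i <- r) hdot (F i) z.
Proof. by rewrite linear_sumlz. Qed.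

Lemma hdotxx x : hdot x x = ((rnorm x ^+ 2)%:C)%C.
Proof. by rewrite -hdot_norm expr2 complexrM rnormE -expr2. Qed.

Lemma hdot_CauchySchwarz x y : cabs (hdot x y) <= rnorm x * rnorm y.
Proof.
rewrite -(@ler_pXn2r _ 2)// ?nnegrE ?mulr_ge0 ?rnorm_ge0// exprMn.
have := @sesqui_CauchySchwarz _ H (@hdot R H) _ _ _ x y.
rewrite !hdotxx; apply=> *; [exact: hdotPl|exact: hdotPr|].
by rewrite hdotxx ler0c sqr_ge0.
Qed.

Lemma cvg_hdotl (u : nat -> H) l y :
  u @ \oo --> l -> (fun n => hdot (u n) y : R[i]^o) @ \oo --> (hdot l y : R[i]^o).
Proof.
apply: (@cvg_lipschitz _ _ R[i]^o (fun x => hdot x y) (rnorm y)) => x z.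
by rewrite -hdotBl mulrC hdot_CauchySchwarz.
Qed.

Lemma rnorm_sqrB x y : rnorm (x - y) ^+ 2 =
  rnorm x ^+ 2 + rnorm y ^+ 2 - 2 * complex.Re (hdot x y).
Proof.
have -> : rnorm (x - y) ^+ 2 = complex.Re (hdot (x - y) (x - y)) by rewrite hdotxx.
by rewrite hdotBl !hdotBr (hdotC x y) !hdotxx !(ReD, ReN) Re_conj/=; ring.
Qed.

Lemma rnorm_sqrD x y : rnorm (x + y) ^+ 2 =
  rnorm x ^+ 2 + rnorm y ^+ 2 + 2 * complex.Re (hdot x y).
Proof.
by rewrite -{1}(opprK y) rnorm_sqrB rnormN hdotNr ReN; ring.
Qed.

Lemma hdot_inj x y : (forall z, hdot z x = hdot z y) -> x = y.
Proof.
move=> xy; apply/eqP; rewrite -subr_eq0; apply/eqP/rnorm0_eq0/eqP.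
rewrite -sqrf_eq0; apply/eqP/complexI.
by rewrite -hdotxx hdotBr xy subrr.
Qed.

(** The representing vector is a multiple of the element of least norm of the
    affine hyperplane [f = 1]: a minimizing sequence is Cauchy by the
    parallelogram law, and minimality makes its limit orthogonal to the kernel
    of [f]. *)
Lemma Riesz_representation (f : H -> R[i]) (M : R) :
  (forall a x y, f (a *: x + y) = a * f x + f y) ->
  (forall x, cabs (f x) <= M * rnorm x) ->
  exists y, forall x, f x = hdot x y.
Proof.
move=> fl fM.
have f0 : f 0 = 0.
  by have := fl (-1) 0 0; rewrite scaleN1r oppr0 addr0 mulN1r addrC subrr.
have fD x y : f (x + y) = f x + f y by rewrite -{1}(scale1r x) fl mul1r.
have fZ a x : f (a *: x) = a * f x by rewrite -{1}(addr0 (a *: x)) fl f0 addr0.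
have fB x y : f (x - y) = f x - f y by rewrite fD -scaleN1r fZ mulN1r.
have [[x0 fx0]|fnul] := pselect (exists x0, f x0 != 0); last first.
  exists 0 => x; rewrite hdot0r; apply/eqP/negPn/negP => fx.
  by apply: fnul; exists x.
pose D := [set rnorm x ^+ 2 | x in [set x | f x = 1]].
have D0 : has_inf D.
  split; first by exists (rnorm ((f x0)^-1 *: x0) ^+ 2), ((f x0)^-1 *: x0);
    rewrite //= fZ mulVf.
  by exists 0 => _ [x _ <-]; exact: sqr_ge0.
pose d := inf D.
have dle x : f x = 1 -> d <= rnorm x ^+ 2.
  by move=> fx; apply: ge_inf; [exact: D0.2|exists x].
have /choice[u uP] : forall n : nat, exists x, f x = 1 /\ rnorm x ^+ 2 <= d + n.+1%:R^-1.
  move=> n; have : 0 < n.+1%:R^-1 :> R by rewrite invr_gt0.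
  by move=> /inf_adherent/(_ D0)[_ [x fx <-]] /ltW; exists x.
(* The midpoint of [u m] and [u n] lies in the hyperplane, so its norm is at
   least [d]. *)
have uC m n : rnorm (u m - u n) ^+ 2 <= 2 * m.+1%:R^-1 + 2 * n.+1%:R^-1.
  have [[fm um] [fn un]] := (uP m, uP n).
  have := dle ((2^-1 : R)%:C%C *: (u m + u n)).
  rewrite fZ fD fm fn (_ : (2^-1)%:C%C * (1 + 1) = 1 :> R[i]); last first.
    by rewrite complexrV -[1 + 1]/(2%:R) (_ : (2 : R)%:C%C = 2%:R) ?mulVf ?pnatr_eq0// rmorph_nat.
  move=> /(_ erefl); rewrite rnorm_realZ exprMn (rnorm_sqrB (u m)) (rnorm_sqrD (u m) (u n)).
  rewrite ger0_norm ?invr_ge0//.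
  by move: um un; move: m.+1%:R^-1 n.+1%:R^-1 => p q; lra.
have /cvg_ex[/= x ux] : cvgn u.
  apply: cauchy_rnorm_cvg => e e0.
  have e4 : 0 < e ^+ 2 / 4 by rewrite divr_gt0// exprn_gt0.
  have [N hN] : exists N : nat, (e ^+ 2 / 4)^-1 <= N.+1%:R.
    exists (Num.truncn ((e ^+ 2 / 4)^-1)).
    by rewrite ltW// truncnS_gt.
  exists N => m n Nm Nn; rewrite -(@ler_pXn2r _ 2)// ?nnegrE ?rnorm_ge0 ?(ltW e0)//.
  apply: (le_trans (uC _ _)).
  have le k : (N <= k)%N -> k.+1%:R^-1 <= e ^+ 2 / 4.
    move=> Nk; rewrite -[leRHS]invrK lef_pV2 ?posrE ?invr_gt0//.
    by rewrite (le_trans hN)// ler_nat.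
  move: (le _ Nm) (le _ Nn); move: m.+1%:R^-1 n.+1%:R^-1 (e ^+ 2) => p q r; lra.
have fx : f x = 1.
  have fu : (fun n => f (u n) : R[i]^o) @ \oo --> (f x : R[i]^o).
    by apply: (@cvg_lipschitz _ _ R[i]^o f M) ux => y z; rewrite -fB.
  apply/eqP; rewrite -subr_eq0; apply/eqP/(@rnorm0_eq0 _ R[i]^o)/eqP.
  rewrite eq_le rnorm_ge0 andbT; apply: epsilon_le => e e0.
  have /cvg_rnormP/(_ _ e0)[N /(_ _ (leqnn _))] := fu.
  by rewrite (uP N).1 add0r rnormB.
have xd : rnorm x ^+ 2 <= d.
  apply: epsilon_le => e e0.
  have : rnorm x <= Num.sqrt (d + e).
    have [N hN] : exists N : nat, e^-1 <= N.+1%:R.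
      by exists (Num.truncn e^-1); rewrite ltW// truncnS_gt.
    apply: (@rnorm_lim_le _ _ u x _ N ux) => n Nn.
    rewrite -[leLHS](ger0_norm (rnorm_ge0 _)) -sqrtr_sqr ler_wsqrtr//.
    apply: le_trans (uP n).2 _; rewrite lerD2l -[leRHS]invrK lef_pV2 ?posrE ?invr_gt0//.
    by rewrite (le_trans hN)// ler_nat.
  rewrite -(@ler_pXn2r _ 2)// ?nnegrE ?rnorm_ge0 ?sqrtr_ge0// sqr_sqrtr//.
  rewrite addr_ge0 ?(ltW e0)//; apply: lb_le_inf; first exact: D0.1.
  by move=> _ [z _ <-]; exact: sqr_ge0.
(* Moving from [x] by [- s <x, v> v] stays in the hyperplane and would decrease
   the norm for this small value of [s], unless [<x, v> = 0]. *)
have orth v : f v = 0 -> hdot v x = 0.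
  move=> fv; apply: (@rnorm0_eq0 _ R[i]^o); apply/eqP; rewrite -sqrf_eq0.
  set s := (rnorm v ^+ 2 + 1)^-1.
  have s0 : 0 < s by rewrite invr_gt0 ltr_wpDl// sqr_ge0.
  have := dle (x - (s%:C%C * (hdot x v)) *: v).
  rewrite fB fZ fx fv mulr0 subr0 => /(_ erefl) /(le_trans xd).
  rewrite rnorm_sqrB rnormZ cabsM cabs_real hdotZr (hdotC v x) cabs_conj.
  set n := cabs _.
  have -> : complex.Re ((s%:C%C * (hdot v x)^*)^* * (hdot v x)^*) = s * n ^+ 2.
    by rewrite /n cabs_sqr; move: (hdot v x) => [e f']; simpc => /=; ring.
  rewrite (ger0_norm (ltW s0)) !exprMn => h; rewrite eq_le sqr_ge0 andbT.
  have sE : s * rnorm v ^+ 2 = 1 - s.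
    by rewrite /s; field; rewrite gt_eqF// ltr_wpDl// sqr_ge0.
  have : 0 <= s * n ^+ 2 * (s * rnorm v ^+ 2 - 2) by nra.
  have s2 : s * rnorm v ^+ 2 - 2 < 0 by rewrite sE; lra.
  by rewrite nmulr_lge0// pmulr_rle0.
have nx : hdot x x != 0.
  rewrite hdotxx; apply/eqP => /complexI/eqP; rewrite sqrf_eq0 => /eqP/rnorm0_eq0 x_0.
  by have := fx; rewrite x_0 f0 => /eqP; rewrite eq_sym oner_eq0.
exists ((hdot x x)^-1^* *: x) => z.
have := orth (z - f z *: x); rewrite fB fZ fx mulr1 subrr => /(_ erefl)/eqP.
rewrite hdotBl hdotZl subr_eq0 => /eqP zx.
by rewrite hdotZr conjCK zx mulrC mulfK.
Qed.

End HilbertSpace.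

Section OperatorAlgebra.
Context {R : realType} {H : hilbertType R}.
Local Notation A := (bop H).
Implicit Types (a b : A) (g h : H).

Lemma bopDE a b h : (a + b : A) h = a h + b h.
Proof. by []. Qed.

Lemma bopBE a b h : (a - b : A) h = a h - b h.
Proof. by []. Qed.

Lemma bopZE (c : R[i]) a h : (c *: a : A) h = c *: a h.
Proof. by []. Qed.

Lemma bopME a b h : (a * b : A) h = a (b h).
Proof. by []. Qed.

Lemma bop1E h : (1 : A) h = h.
Proof. by []. Qed.

Lemma bop0E h : (0 : A) h = 0.
Proof. by []. Qed.

Lemma bop_scalerAl (c : R[i]) a b : (c *: a : A) * b = c *: (a * b : A).
Proof. exact: bopP. Qed.

Lemma bop_scalerAr (c : R[i]) a b : a * (c *: b : A) = c *: (a * b : A).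
Proof. by apply: bopP => h; rewrite bopME bopZE linearZ. Qed.

Lemma bop_sumE (I : Type) (r : seq I) (F : I -> A) h :
  (\sum_(i <- r) F i : A) h = \sum_(i <- r) F i h.
Proof. by elim/big_rec2: _ => // i x y _ <-. Qed.

Lemma bop_le a h : rnorm (a h) <= rnorm a * rnorm h.
Proof.
have [->|h0] := eqVneq h 0; first by rewrite linear0 !rnorm0 mulr0.
have nh : 0 < rnorm h by rewrite rnorm_gt0.
have := @bop_norm_le1 _ _ a (((rnorm h)^-1)%:C%C *: h).
rewrite linearZ/= !rnorm_realZ ger0_norm ?invr_ge0 ?(ltW nh)// mulVf ?gt_eqF//.
by move=> /(_ (lexx _)); rewrite mulrC ler_pdivrMr.
Qed.

Lemma bop_leP a (c : R) : 0 <= c ->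
  (forall h, rnorm (a h) <= c * rnorm h) <-> rnorm a <= c.
Proof.
move=> c0; split=> [ac|ac h]; last by rewrite (le_trans (bop_le _ _))// ler_wpM2r// rnorm_ge0.
by apply: bop_norm_le => h h1; rewrite (le_trans (ac _))// ler_piMr.
Qed.

(** The operator norm is the norm of the sesquilinear form: take [g = a h]. *)
Lemma bop_le_form a (c : R) : 0 <= c ->
  (forall h g, cabs (hdot (a h) g) <= c * rnorm h * rnorm g) -> rnorm a <= c.
Proof.
move=> c0 ac; apply/bop_leP => // h.
have [ah0|ah0] := eqVneq (a h) 0; first by rewrite ah0 rnorm0 mulr_ge0 ?rnorm_ge0.
have := ac h (a h); rewrite hdotxx cabs_real ger0_norm ?sqr_ge0// expr2.
by rewrite ler_pM2r// rnorm_gt0.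
Qed.

Lemma rnorm_bop1 : rnorm (1 : A) <= 1.
Proof. by apply/bop_leP => // h; rewrite mul1r. Qed.

(** The pointwise limit of a Cauchy sequence of operators is again a bounded
    operator, and the convergence is uniform on balls. *)
Lemma bop_cauchy_cvg (u : nat -> A) :
  (forall e : R, 0 < e ->
    exists N, forall m n, (N <= m)%N -> (N <= n)%N -> rnorm (u m - u n) <= e) ->
  cvgn u.
Proof.
move=> uC.
have uCh h (e : R) : 0 < e -> exists N, forall m n, (N <= m)%N -> (N <= n)%N ->
    rnorm (u m h - u n h) <= e.
  move=> e0; have h1 : 0 < rnorm h + 1 by rewrite ltr_wpDl// rnorm_ge0.
  have [N hN] := uC _ (divr_gt0 e0 h1); exists N => m n Nm Nn.
  rewrite -bopBE (le_trans (bop_le _ _))//.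
  apply: (@le_trans _ _ (e / (rnorm h + 1) * (rnorm h + 1))); last by rewrite divfK ?gt_eqF.
  by rewrite ler_pM ?rnorm_ge0 ?hN// lerDl.
have /choice[l ul] : forall h, exists l : H, (fun n => u n h) @ \oo --> l.
  by move=> h; have /cauchy_rnorm_cvg/cvg_ex[] := uCh h; move=> l; exists l.
have ll : linear l.
  move=> c x y; apply: (seq_cvg_unique (ul _)).
  rewrite (_ : (fun n => u n (c *: x + y)) = (fun n => c *: u n x + u n y)); last first.
    by apply/funext => n; rewrite linearP.
  by apply: cvgD (ul y); apply: cvgZl_tmp (ul x).
have lu (e : R) : 0 < e -> exists N, forall n, (N <= n)%N ->
    forall h, rnorm (l h - u n h) <= e * rnorm h.
  move=> e0; have [N hN] := uC _ e0; exists N => n Nn h.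
  apply: (@rnorm_lim_le _ _ (fun m => u m h - u n h) _ _ N).
    by apply: cvgB (ul h) _; exact: cvg_cst.
  by move=> m Nm; rewrite -bopBE (le_trans (bop_le _ _))// ler_wpM2r ?rnorm_ge0 ?hN.
have lP : l \in @bop_pred _ H.
  apply/asboolP; split=> //; have [N /(_ _ (leqnn N)) hN] := lu _ ltr01.
  exists (1 + rnorm (u N)) => x; rewrite mulrDl.
  by rewrite -[X in rnorm X <= _](subrK (u N x)) (le_trans (ler_rnormD _ _))// lerD// bop_le.
apply/cvg_ex; exists (exist (fun f : H -> H => f \in @bop_pred _ H) l lP : A).
apply/cvg_rnormP => e e0; have [N hN] := lu _ e0; exists N => n Nn.
by apply/(bop_leP _ (ltW e0)) => h; rewrite rnormB; exact: hN.
Qed.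

Lemma bop_cvg_eval (u : nat -> A) a h :
  u @ \oo --> a -> (fun n => u n h) @ \oo --> a h.
Proof.
apply: (@cvg_lipschitz _ _ _ (fun b : A => b h) (rnorm h)) => b c.
by rewrite -bopBE mulrC bop_le.
Qed.

(** The Riesz representation theorem provides the adjoint, so the default
    value in its definition is never taken. *)
Lemma hdot_adj a g h : hdot (a g) h = hdot g (bop_adj a h).
Proof.
suff [b bP] : exists b : A, forall x y : H, hdot (a x) y = hdot x (b y).
  by rewrite /bop_adj; case: xgetP => [c -> /= ->//|/(_ b)]; case.
have /choice[b bP] y : exists z, forall x, hdot (a x) y = hdot x z.
  apply: (@Riesz_representation _ _ _ (rnorm a * rnorm y)).
    by move=> c u v; rewrite linearP hdotPl.
  move=> x; rewrite (le_trans (hdot_CauchySchwarz _ _))// mulrAC.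
  by rewrite ler_wpM2r ?rnorm_ge0 ?bop_le.
have bl : linear b.
  by move=> c x y; apply: hdot_inj => z; rewrite -bP !hdotPr -!bP.
have bb : b \in @bop_pred _ H.
  apply/asboolP; split=> //; exists (rnorm a) => x.
  have [bx0|bx0] := eqVneq (b x) 0; first by rewrite bx0 rnorm0 mulr_ge0 ?rnorm_ge0.
  have : cabs (hdot (a (b x)) x) <= rnorm a * rnorm (b x) * rnorm x.
    by rewrite (le_trans (hdot_CauchySchwarz _ _))// ler_wpM2r ?rnorm_ge0 ?bop_le.
  rewrite bP hdotxx cabs_real ger0_norm ?sqr_ge0// expr2 mulrAC.
  by rewrite ler_pM2r// rnorm_gt0.
by exists (exist (fun f : H -> H => f \in @bop_pred _ H) b bb : A).
Qed.

Lemma hdot_adjr a g h : hdot g (a h) = hdot (bop_adj a g) h.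
Proof. by rewrite hdotC hdot_adj -hdotC. Qed.

Lemma hdot_adjM a b g h : hdot ((bop_adj a * b : A) h) g = hdot (b h) (a g).
Proof. by rewrite bopME hdot_adjr. Qed.

Lemma bop_eq_form a b : (forall h g, hdot (a h) g = hdot (b h) g) -> a = b.
Proof.
by move=> ab; apply: bopP => h; apply: hdot_inj => g; rewrite hdotC ab -hdotC.
Qed.

Lemma bop_adj1 : bop_adj (1 : A) = 1.
Proof. by apply: bop_eq_form => h g; rewrite -hdot_adjr. Qed.

Lemma bop_adjD a b : bop_adj (a + b) = bop_adj a + bop_adj b.
Proof.
apply: bop_eq_form => h g; rewrite -hdot_adjr !bopDE hdotDl -!hdot_adjr.
by rewrite hdotDr.
Qed.

Lemma bop_adjZ (c : R[i]) a : bop_adj (c *: a) = c^* *: bop_adj a.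
Proof.
by apply: bop_eq_form => h g; rewrite -hdot_adjr !bopZE hdotZl hdotZr -hdot_adjr.
Qed.

Lemma bop_adjK a : bop_adj (bop_adj a) = a.
Proof. by apply: bop_eq_form => h g; rewrite -hdot_adjr -hdot_adj. Qed.

Lemma rnorm_adjM a : rnorm (bop_adj a * a) <= rnorm a ^+ 2.
Proof.
apply: bop_le_form => [|h g]; first exact: sqr_ge0.
rewrite hdot_adjM (le_trans (hdot_CauchySchwarz _ _))//.
by rewrite [leRHS](_ : _ = (rnorm a * rnorm h) * (rnorm a * rnorm g)); [rewrite ler_pM ?rnorm_ge0 ?bop_le|ring].
Qed.

Fact ket_bra_subproof (v h : H) : (fun g => hdot g h *: v) \in @bop_pred _ H.
Proof.
apply/asboolP; split=> [c x y|]; first by rewrite hdotPl scalerDl scalerA.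
exists (rnorm h * rnorm v) => x; rewrite rnormZ mulrAC ler_wpM2r ?rnorm_ge0//.
by rewrite mulrC hdot_CauchySchwarz.
Qed.

(** Dirac's rank-one operator; when [h] is a unit vector, it takes the value
    [v] at [h] and has the norm of [v], which lifts vectors of [H] to elements
    of the algebra. *)
Definition ket_bra (v h : H) : A :=
  exist (fun f : H -> H => f \in @bop_pred _ H) _ (ket_bra_subproof v h).

Lemma ket_braE v h g : ket_bra v h g = hdot g h *: v.
Proof. by []. Qed.

End OperatorAlgebra.

(** * The standard Hilbert module *)

Section StandardModule.
Context {R : realType} {H : hilbertType R}.
Local Notation A := (bop H).
Implicit Types (x y z : nat -> A) (g h : H) (a : A).

Lemma sum_hdot_le (r : seq nat) x y h g (p q : R) : 0 <= p -> 0 <= q ->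
  \sum_(j <- r) rnorm (y j h) ^+ 2 <= p ^+ 2 ->
  \sum_(j <- r) rnorm (x j g) ^+ 2 <= q ^+ 2 ->
  cabs (\sum_(j <- r) hdot (y j h) (x j g)) <= p * q.
Proof.
move=> p0 q0 yp xq.
have le1 : cabs (\sum_(j <- r) hdot (y j h) (x j g)) <=
    \sum_(j <- r) rnorm (y j h) * rnorm (x j g).
  apply: (le_trans (@rnorm_sum _ R[i]^o _ _ _)).
  by apply: ler_sum => j _; exact: hdot_CauchySchwarz.
apply: (le_trans le1); rewrite -(@ler_pXn2r _ 2)//; last 2 first.
- by rewrite nnegrE sumr_ge0// => j _; rewrite mulr_ge0 ?rnorm_ge0.
- by rewrite nnegrE mulr_ge0.
apply: le_trans (sum_CauchySchwarz _ _ _) _; rewrite exprMn.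
by rewrite ler_pM// sumr_ge0// => j _; rewrite sqr_ge0.
Qed.

Lemma series_diff (V : zmodType) (u : nat -> V) m n : (m <= n)%N ->
  series u n - series u m = \sum_(m <= j < n) u j.
Proof.
by move=> mn; rewrite /series/= (big_cat_nat (leq0n m) mn)/= addrAC subrr add0r.
Qed.

Lemma hdot_sum_adjM (r : seq nat) x y h g :
  hdot ((\sum_(j <- r) bop_adj (x j) * y j : A) h) g =
  \sum_(j <- r) hdot (y j h) (x j g).
Proof.
rewrite bop_sumE hdot_suml; apply: eq_bigr => j _; exact: hdot_adjM.
Qed.

Lemma Re_sum_hdot_diag (r : seq nat) x h :
  complex.Re (\sum_(j <- r) hdot (x j h) (x j h)) = \sum_(j <- r) rnorm (x j h) ^+ 2.
Proof. by rewrite Re_sum; apply: eq_bigr => j _; rewrite hdotxx. Qed.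

(** Norm convergence of the defining series is a Cauchy condition on the
    quadratic forms; in this shape it involves no operator order and is stable
    under domination. *)
Lemma l2P x : l2 x <-> forall e : R, 0 < e -> exists N, forall m n,
  (N <= m)%N -> (m <= n)%N -> forall h,
  \sum_(m <= j < n) rnorm (x j h) ^+ 2 <= (e * rnorm h) ^+ 2.
Proof.
split=> [/cvg_ex[/= s /cvg_rnormP xs] e e0|xC].
  have e2 : 0 < e ^+ 2 / 2 by rewrite divr_gt0// exprn_gt0.
  have [N hN] := xs _ e2; exists N => m n Nm mn h.
  rewrite -Re_sum_hdot_diag -hdot_sum_adjM.
  rewrite -(series_diff (fun j => bop_adj (x j) * x j))//.
  apply: (le_trans (Re_le_nm _)); apply: (le_trans (hdot_CauchySchwarz _ _)).
  rewrite exprMn [rnorm h ^+ 2]expr2 mulrA ler_wpM2r ?rnorm_ge0//.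
  apply: (le_trans (bop_le _ _)); rewrite ler_wpM2r ?rnorm_ge0//.
  have := hN _ Nm; have := hN _ (leq_trans Nm mn).
  set sn := series _ n; set sm := series _ m => h1 h2.
  rewrite (_ : sn - sm = (sn - s) - (sm - s)); last by rewrite opprB addrA subrK.
  apply: (le_trans (ler_rnormD _ _)); rewrite rnormN; lra.
apply: bop_cauchy_cvg => e e0.
have [N hN] := xC (Num.sqrt e) ltac:(by rewrite sqrtr_gt0); exists N => m n.
wlog mn : m n / (m <= n)%N.
  by move=> W Nm Nn; have [mn|/ltnW nm] := leqP m n; [|rewrite rnormB]; exact: W.
move=> Nm _; rewrite rnormB series_diff//; apply: bop_le_form => [|h g]; first exact: ltW.
rewrite hdot_sum_adjM -(sqr_sqrtr (ltW e0)) expr2.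
rewrite (_ : _ * _ * _ * _ = (Num.sqrt e * rnorm h) * (Num.sqrt e * rnorm g)); last by ring.
by apply: sum_hdot_le; rewrite ?mulr_ge0 ?sqrtr_ge0 ?rnorm_ge0 ?hN.
Qed.

Lemma l2dot_cvg x y : l2 x -> l2 y ->
  series (fun j => bop_adj (x j) * y j) @ \oo --> l2dot x y.
Proof.
move=> /l2P xC /l2P yC; apply: bop_cauchy_cvg => e e0.
have [N hN] := xC _ ltr01; have [M hM] := yC _ e0; exists (maxn N M) => m n.
wlog mn : m n / (m <= n)%N.
  by move=> W Nm Nn; have [mn|/ltnW nm] := leqP m n; [|rewrite rnormB]; exact: W.
rewrite geq_max => /andP[Nm Mm] _; rewrite rnormB series_diff//.
apply: bop_le_form => [|h g]; first exact: ltW.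
rewrite hdot_sum_adjM -[rnorm g]mul1r.
by apply: sum_hdot_le; rewrite ?mulr_ge0 ?rnorm_ge0 ?hN ?hM// ltW.
Qed.

Lemma l2dot_form_cvg x y h g : l2 x -> l2 y ->
  (fun n => \sum_(0 <= j < n) hdot (y j h) (x j g) : R[i]^o) @ \oo -->
  (hdot (l2dot x y h) g : R[i]^o).
Proof.
move=> x2 y2; under eq_fun do rewrite -hdot_sum_adjM.
exact/cvg_hdotl/bop_cvg_eval/l2dot_cvg.
Qed.

Arguments l2dot_form_cvg [x y] h g _ _.

Lemma l2norm_ge0 x : 0 <= l2norm x.
Proof. exact: sqrtr_ge0. Qed.

Lemma l2norm_sqr x : l2norm x ^+ 2 = rnorm (l2dot x x).
Proof. by rewrite sqr_sqrtr// rnorm_ge0. Qed.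

(** The bounds at the two vectors are kept separate: testing at one fixed vector
    can be sharper than the norm of [l2norm], and it is the form needed when
    the adjoint is bounded below at a single vector. *)
Lemma l2dot_form_le x y h g (p q : R) : l2 x -> l2 y -> 0 <= p -> 0 <= q ->
  (forall n, \sum_(0 <= j < n) rnorm (y j h) ^+ 2 <= p ^+ 2) ->
  (forall n, \sum_(0 <= j < n) rnorm (x j g) ^+ 2 <= q ^+ 2) ->
  cabs (hdot (l2dot x y h) g) <= p * q.
Proof.
move=> x2 y2 p0 q0 yp xq.
apply: (@rnorm_lim_le _ R[i]^o _ _ _ 0 (l2dot_form_cvg h g x2 y2)) => n _.
exact: sum_hdot_le.
Qed.

(** The partial sums of the series of squared norms increase to the diagonal
    value of the form. *)
Lemma sum_le_l2dot_diag x h m n : l2 x ->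
  \sum_(m <= j < n) rnorm (x j h) ^+ 2 <= complex.Re (hdot (l2dot x x h) h).
Proof.
move=> x2; apply: epsilon_le => e e0.
have /cvg_rnormP/(_ _ e0)[N hN] := l2dot_form_cvg h h x2 x2.
have := hN _ (leq_maxl N n).
set s : R[i] := \sum_(0 <= j < maxn N n) _.
set t : R[i] := hdot (l2dot x x h) h => st.
have nN : \sum_(m <= j < n) rnorm (x j h) ^+ 2 <= complex.Re s.
  rewrite Re_sum_hdot_diag (big_cat_nat (leq0n n) (leq_maxr N n))/=.
  have [mn|nm] := leqP m n; last first.
    by rewrite big_geq ?(ltnW nm)// addr_ge0// sumr_ge0// => j _; exact: sqr_ge0.
  rewrite (big_cat_nat (leq0n m) mn)/= addrAC lerDr addr_ge0//.
    by apply: sumr_ge0 => j _; exact: sqr_ge0.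
  by apply: sumr_ge0 => j _; exact: sqr_ge0.
apply: (le_trans nN); rewrite (_ : s = t + (s - t)); last by rewrite addrC subrK.
by rewrite ReD lerD//; exact: le_trans (Re_le_nm _) st.
Qed.

Lemma l2norm_sum x h m n : l2 x ->
  \sum_(m <= j < n) rnorm (x j h) ^+ 2 <= (l2norm x * rnorm h) ^+ 2.
Proof.
move=> x2; apply: (le_trans (sum_le_l2dot_diag h m n x2)).
apply: (le_trans (Re_le_nm _)); apply: (le_trans (hdot_CauchySchwarz _ _)).
by rewrite exprMn l2norm_sqr expr2 mulrA ler_wpM2r ?rnorm_ge0// bop_le.
Qed.

Lemma l2norm_leP x (c : R) : l2 x -> 0 <= c ->
  (l2norm x <= c <->
   forall h n, \sum_(0 <= j < n) rnorm (x j h) ^+ 2 <= (c * rnorm h) ^+ 2).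
Proof.
move=> x2 c0; split=> [xc h n|xc].
  apply: (le_trans (l2norm_sum _ _ _ x2)).
  by rewrite lerXn2r ?nnegrE ?mulr_ge0 ?l2norm_ge0 ?rnorm_ge0// ler_wpM2r ?rnorm_ge0.
rewrite -(@ler_pXn2r _ 2) ?nnegrE ?l2norm_ge0// l2norm_sqr.
apply: bop_le_form => [|h g]; first exact: sqr_ge0.
rewrite (_ : _ * _ * _ = (c * rnorm h) * (c * rnorm g)); last by ring.
by apply: l2dot_form_le; rewrite ?mulr_ge0 ?rnorm_ge0.
Qed.

(** One domination principle covers sums, differences, opposites and
    truncations. *)
Lemma l2_dominated x y z :
  (forall j h, rnorm (z j h) <= rnorm (x j h) + rnorm (y j h)) ->
  l2 x -> l2 y -> l2 z /\ l2norm z <= l2norm x + l2norm y.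
Proof.
move=> zxy x2 y2; have dom h j : 0 <= rnorm (z j h) <= rnorm (x j h) + rnorm (y j h).
  by rewrite rnorm_ge0 zxy.
have z2 : l2 z.
  apply/l2P => e e0; have e2 : 0 < e / 2 by rewrite divr_gt0.
  have /l2P/(_ _ e2)[N hN] := x2; have /l2P/(_ _ e2)[M hM] := y2.
  exists (maxn N M) => m n; rewrite geq_max => /andP[Nm Mm] mn h.
  rewrite (_ : e * rnorm h = e / 2 * rnorm h + e / 2 * rnorm h); last by field.
  have e2h : 0 <= e / 2 * rnorm h by rewrite mulr_ge0 ?rnorm_ge0// ltW.
  exact: (sum_Minkowski (dom h) e2h e2h (hN _ _ Nm mn h) (hM _ _ Mm mn h)).
split=> //; apply/l2norm_leP; rewrite ?addr_ge0 ?l2norm_ge0// => h n.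
rewrite mulrDl; apply: (sum_Minkowski (dom h));
  by rewrite ?mulr_ge0 ?rnorm_ge0 ?l2norm_ge0 ?l2norm_sum.
Qed.

Lemma l2_0 : l2 (0 : nat -> A).
Proof.
apply/l2P => e e0; exists 0 => m n _ _ h.
by rewrite big1 ?sqr_ge0// => j _; rewrite rnorm0 expr0n.
Qed.

Lemma l2norm0 : l2norm (0 : nat -> A) = 0.
Proof.
apply/eqP; rewrite eq_le l2norm_ge0 andbT; apply/(l2norm_leP l2_0) => // h n.
by rewrite big1 ?sqr_ge0// => j _; rewrite rnorm0 expr0n.
Qed.

Lemma l2_dominated1 x z : (forall j h, rnorm (z j h) <= rnorm (x j h)) ->
  l2 x -> l2 z /\ l2norm z <= l2norm x.
Proof.
move=> zx x2; have zx0 j h : rnorm (z j h) <= rnorm (x j h) + rnorm ((0 : nat -> A) j h).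
  by rewrite rnorm0 addr0.
by have := l2_dominated zx0 x2 l2_0; rewrite l2norm0 addr0.
Qed.

Lemma l2D x y : l2 x -> l2 y -> l2 (x + y).
Proof.
by move=> x2 y2; apply: (proj1 (l2_dominated _ x2 y2)) => j h; exact: ler_rnormD.
Qed.

Lemma ler_l2normD x y : l2 x -> l2 y -> l2norm (x + y) <= l2norm x + l2norm y.
Proof.
by move=> x2 y2; apply: (proj2 (l2_dominated _ x2 y2)) => j h; exact: ler_rnormD.
Qed.

Lemma l2N x : l2 x -> l2 (- x).
Proof.
by move=> x2; apply: (proj1 (l2_dominated1 _ x2)) => j h; rewrite rnormN.
Qed.

Lemma l2B x y : l2 x -> l2 y -> l2 (x - y).
Proof. by move=> x2 y2; apply: l2D => //; exact: l2N. Qed.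

Lemma ler_l2normB x y : l2 x -> l2 y -> l2norm (x - y) <= l2norm x + l2norm y.
Proof.
move=> x2 y2; apply: (proj2 (l2_dominated _ x2 y2)) => j h.
by rewrite (le_trans (ler_rnormD _ _))// rnormN.
Qed.

Lemma l2_rscale_norm x a : l2 x -> l2 (rscale x a) /\ l2norm (rscale x a) <= l2norm x * rnorm a.
Proof.
move=> x2.
have xa2 : l2 (rscale x a).
  apply/l2P => e e0; have a1 : 0 < rnorm a + 1 by rewrite ltr_wpDl// rnorm_ge0.
  have /l2P/(_ _ (divr_gt0 e0 a1))[N hN] := x2; exists N => m n Nm mn h.
  apply: (le_trans (hN _ _ Nm mn (a h))).
  have ea : 0 <= e / (rnorm a + 1) by rewrite divr_ge0 ?ltW.
  apply: ler_sqr_nneg; first by rewrite mulr_ge0// rnorm_ge0.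
  rewrite mulrAC ler_pdivrMr// -mulrA ler_wpM2l ?(ltW e0)//.
  by rewrite (le_trans (bop_le _ _))// mulrC ler_wpM2l ?rnorm_ge0// lerDl.
split=> //; apply/(l2norm_leP xa2) => [|h n]; first by rewrite mulr_ge0 ?l2norm_ge0 ?rnorm_ge0.
apply: (le_trans (l2norm_sum (a h) 0 n x2)).
rewrite lerXn2r ?nnegrE ?mulr_ge0 ?rnorm_ge0 ?l2norm_ge0//.
by rewrite -mulrA ler_wpM2l ?l2norm_ge0 ?bop_le.
Qed.

Lemma l2_rscale x a : l2 x -> l2 (rscale x a).
Proof. by move=> /(l2_rscale_norm a)[]. Qed.

Arguments l2_rscale [x] a _.

Lemma l2norm_rscale x a : l2 x -> l2norm (rscale x a) <= l2norm x * rnorm a.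
Proof. by move=> /(l2_rscale_norm a)[]. Qed.

(** This makes module maps homogeneous for complex scalars. *)
Lemma rscale_scalar (c : R[i]) x : rscale x (c *: (1 : A)) = c *: x.
Proof. by apply/funext => j; apply: bopP => h; rewrite /rscale bopME linearZ. Qed.

Lemma rnorm_scalar (c : R[i]) : rnorm (c *: (1 : A)) <= cabs c.
Proof. by rewrite rnormZ ler_piMr ?rnorm_ge0 ?rnorm_bop1. Qed.

Lemma l2Z (c : R[i]) x : l2 x -> l2 (c *: x).
Proof. by rewrite -rscale_scalar; exact: l2_rscale. Qed.

Arguments l2Z c [x] _.

Lemma l2normZ_le (c : R[i]) x : l2 x -> l2norm (c *: x) <= cabs c * l2norm x.
Proof.
move=> x2; rewrite -rscale_scalar (le_trans (l2norm_rscale _ x2))// mulrC.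
by rewrite ler_wpM2r ?l2norm_ge0 ?rnorm_scalar.
Qed.

Lemma l2_sum (I : Type) (r : seq I) (F : I -> nat -> A) :
  (forall i, l2 (F i)) -> l2 (\sum_(i <- r) F i) /\
  l2norm (\sum_(i <- r) F i) <= \sum_(i <- r) l2norm (F i).
Proof.
move=> F2; elim: r => [|i r [IH1 IH2]].
  by rewrite !big_nil l2norm0; split=> //; exact: l2_0.
rewrite !big_cons; split; first exact: l2D.
by rewrite (le_trans (ler_l2normD _ _))// lerD2l.
Qed.

Lemma rnorm_l2dot x y : l2 x -> l2 y -> rnorm (l2dot x y) <= l2norm x * l2norm y.
Proof.
move=> x2 y2; apply: bop_le_form => [|h g]; first by rewrite mulr_ge0 ?l2norm_ge0.
rewrite (_ : _ * _ * _ * _ = (l2norm y * rnorm h) * (l2norm x * rnorm g)); last by ring.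
by apply: l2dot_form_le; rewrite ?mulr_ge0 ?l2norm_ge0 ?rnorm_ge0// => n; exact: l2norm_sum.
Qed.

Lemma l2dotC x y : l2 x -> l2 y -> l2dot y x = bop_adj (l2dot x y).
Proof.
move=> x2 y2; apply: bop_eq_form => h g; rewrite -hdot_adjr.
rewrite [RHS]hdotC -(conjCK (hdot (l2dot y x h) g)); congr (_^*).
apply: (@seq_cvg_unique _ R[i]^o _ _ _ _ (l2dot_form_cvg g h x2 y2)).
have conjL (z w : R[i]^o) : cabs (z^* - w^*) <= 1 * cabs (z - w).
  by rewrite mul1r -rmorphB cabs_conj.
have := cvg_lipschitz (f := Num.conj : R[i]^o -> R[i]^o) conjL (l2dot_form_cvg h g y2 x2).
apply: cvg_trans; apply: near_eq_cvg; near=> n.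
by rewrite rmorph_sum/=; apply: eq_bigr => j _; rewrite -hdotC.
Unshelve. all: by end_near. Qed.

Lemma l2norm_le_coef x j : l2 x -> rnorm (x j) <= l2norm x.
Proof.
move=> x2; apply/(bop_leP _ (l2norm_ge0 x)) => h.
rewrite -(@ler_pXn2r _ 2) ?nnegrE ?mulr_ge0 ?rnorm_ge0 ?l2norm_ge0//.
by have := l2norm_sum h j j.+1 x2; rewrite big_nat1.
Qed.

(** ** Truncations *)

Definition l2trunc n x : nat -> A := fun j => if (j < n)%N then x j else 0.
Definition l2tail n x : nat -> A := fun j => if (j < n)%N then 0 else x j.

Lemma l2trunc_tail n x : x = l2trunc n x + l2tail n x.
Proof.
by apply/funext => j; rewrite fctE /l2trunc /l2tail; case: ifP; rewrite ?addr0 ?add0r.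
Qed.

Lemma l2_tail n x : l2 x -> l2 (l2tail n x).
Proof.
move=> x2; apply: (proj1 (l2_dominated1 _ x2)) => j h.
by rewrite /l2tail; case: ifP => // _; rewrite rnorm0 rnorm_ge0.
Qed.

Arguments l2_tail n [x] _.

Lemma l2_finite n x : (forall j, (n <= j)%N -> x j = 0) -> l2 x.
Proof.
move=> x0; apply/l2P => e e0; exists n => m k nk _ h.
rewrite big_nat big1 ?sqr_ge0// => j /andP[mj _].
by rewrite x0 ?(leq_trans nk)// rnorm0 expr0n.
Qed.

Lemma l2_trunc n x : l2 (l2trunc n x).
Proof. by apply: (@l2_finite n) => j nj; rewrite /l2trunc ltnNge nj. Qed.

Arguments l2_trunc n x : clear implicits.

Lemma l2norm_tail_small x : l2 x ->
  forall e : R, 0 < e -> exists N, forall n, (N <= n)%N -> l2norm (l2tail n x) <= e.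
Proof.
move=> x2 e e0; have /l2P/(_ _ e0)[N hN] := x2; exists N => n Nn.
apply/(l2norm_leP (l2_tail n x2) (ltW e0)) => h k.
have [kn|nk] := leqP k n.
  rewrite big_nat big1 ?sqr_ge0// => j /= jk; rewrite /l2tail (leq_trans jk kn).
  by rewrite rnorm0 expr0n.
rewrite (big_cat_nat (leq0n n) (ltnW nk))/= big_nat big1 ?add0r => [|j /= jn].
  rewrite big_nat (eq_bigr (fun j => rnorm (x j h) ^+ 2)) -?big_nat ?hN// 1?ltnW//.
  by move=> j /andP[nj _]; rewrite /l2tail ltnNge nj.
by rewrite /l2tail jn rnorm0 expr0n.
Qed.

Lemma l2dot_finite n x y : (forall j, (n <= j)%N -> y j = 0) ->
  l2dot x y = \sum_(0 <= j < n) bop_adj (x j) * y j.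
Proof.
move=> y0; apply: norm_cvg_lim; apply: (@cvg_rnormP R A _ _).2 => e e0.
exists n => k nk; rewrite /series/= (big_cat_nat (leq0n n) nk)/=.
rewrite [X in _ + X - _](_ : _ = 0) ?addr0 ?subrr ?rnorm0 ?(ltW e0)//.
by rewrite big_nat big1// => j /andP[nj _]; rewrite y0// mulr0.
Qed.

End StandardModule.

Arguments l2dot_form_cvg {R H} [x y] h g _ _.
Arguments l2_tail {R H} n [x] _.
Arguments l2_trunc {R H} n x.
Arguments l2_rscale {R H} [x] a _.
Arguments l2Z {R H} c [x] _.

(** * Normal states and the semi-norms *)

Lemma Bernoulli_inequality (R : realFieldType) (d : R) (n : nat) :
  0 <= d -> 1 + n%:R * d <= (1 + d) ^+ n.
Proof.
move=> d0; elim: n => [|n IH]; first by rewrite mul0r addr0 expr0.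
rewrite exprS -natr1; apply: (@le_trans _ _ ((1 + d) * (1 + n%:R * d))).
  have : 0 <= n%:R * d * d by rewrite !mulr_ge0 ?ler0n.
  by move: (n%:R) => k; nra.
by rewrite ler_wpM2l// addr_ge0.
Qed.

(** If [t] were larger than [s], the powers of [t / s] would eventually exceed
    [C]. *)
Lemma ler_of_powers (R : realType) (s t C : R) : 0 <= s ->
  (forall k : nat, t ^+ (2 ^ k) <= C * s ^+ (2 ^ k)) -> t <= s.
Proof.
move=> s0 tC; rewrite leNgt; apply/negP => st.
have [s_eq0|s_neq0] := eqVneq s 0.
  by have := tC 0; rewrite expn0 !expr1 s_eq0 mulr0 leNgt -s_eq0 st.
have s_gt0 : 0 < s by rewrite lt_def s_neq0.
pose d := t / s - 1.
have d0 : 0 < d by rewrite subr_gt0 ltr_pdivlMr// mul1r.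
have tE : t = s * (1 + d) by rewrite /d; field; rewrite gt_eqF.
have powC k : (1 + d) ^+ (2 ^ k) <= C.
  by have := tC k; rewrite tE exprMn mulrC ler_pM2r// exprn_gt0.
pose k := Num.truncn (C / d).
have := le_trans (Bernoulli_inequality (2 ^ k) (ltW d0)) (powC k).
apply/negP; rewrite -ltNge; apply: (@lt_le_trans _ _ (k.+1%:R * d)).
  by rewrite -ltr_pdivrMr// truncnS_gt.
rewrite (@le_trans _ _ ((2 ^ k)%:R * d))// ?lerDr//.
by rewrite ler_pM2r// ler_nat ltn_expl.
Qed.

Section NormalStates.
Context {R : realType} {H : hilbertType R}.
Local Notation A := (bop H).
Implicit Types (a b : A) (x y z : nat -> A) (h : H).

Lemma series_le_lim (u : nat -> R) n : (forall j, 0 <= u j) -> cvgn (series u) ->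
  \sum_(0 <= j < n) u j <= limn (series u).
Proof.
move=> u0 cu; apply: (nondecreasing_cvgn_le _ cu n).
by apply/nondecreasing_seqP => k; rewrite /series/= big_nat_recr//= lerDl.
Qed.

(** From [s t <= s^2 + t^2], applied to the norms of the two sequences of
    vectors. *)
Lemma predual_bounded (phi : {scalar A}) : predual phi ->
  exists C : R, 0 <= C /\ forall a, cabs (phi a) <= C * rnorm a.
Proof.
move=> [xi [eta [xi2 eta2 phiE]]].
set P := limn (series (fun n => rnorm (xi n) ^+ 2)).
set Q := limn (series (fun n => rnorm (eta n) ^+ 2)).
have xiP n : \sum_(0 <= j < n) rnorm (xi j) ^+ 2 <= P.
  by apply: series_le_lim => // j; exact: sqr_ge0.
have etaQ n : \sum_(0 <= j < n) rnorm (eta j) ^+ 2 <= Q.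
  by apply: series_le_lim => // j; exact: sqr_ge0.
have P0 : 0 <= P by have := xiP 0; rewrite big_geq.
have Q0 : 0 <= Q by have := etaQ 0; rewrite big_geq.
exists (P + Q); split=> [|a]; first exact: addr_ge0.
apply: (@rnorm_lim_le _ R[i]^o _ _ _ 0 (phiE a)) => n _.
apply: (le_trans (@rnorm_sum _ R[i]^o _ _ _)).
apply: (@le_trans _ _ ((\sum_(0 <= j < n) rnorm (xi j) ^+ 2 +
    \sum_(0 <= j < n) rnorm (eta j) ^+ 2) * rnorm a)); last first.
  by rewrite ler_wpM2r ?rnorm_ge0// lerD.
rewrite -big_split mulr_suml; apply: ler_sum => j _ /=.
apply: (le_trans (hdot_CauchySchwarz _ _)).
apply: (@le_trans _ _ (rnorm a * rnorm (xi j) * rnorm (eta j))).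
  by rewrite ler_wpM2r ?rnorm_ge0 ?bop_le.
rewrite mulrC mulrCA mulrC ler_wpM2r ?rnorm_ge0//.
have := rnorm_ge0 (xi j); have := rnorm_ge0 (eta j).
by move: (rnorm _) (rnorm _) => s t; nra.
Qed.

Variable phi : {scalar A}.
Hypothesis phiN : normal_state phi.

Lemma state_ge0 a : 0 <= phi (bop_adj a * a).
Proof. by case: phiN. Qed.

Lemma state_CauchySchwarz a b : cabs (phi (bop_adj a * b)) ^+ 2 <=
  complex.Re (phi (bop_adj a * a)) * complex.Re (phi (bop_adj b * b)).
Proof.
rewrite [leRHS]mulrC.
apply: (@sesqui_CauchySchwarz _ A (fun u v => phi (bop_adj v * u)) _ _ _ b a) => [c u v w|c u v w|u].
- by rewrite mulrDr linearD/= bop_scalerAr linearZ.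
- by rewrite bop_adjD bop_adjZ mulrDl linearD/= bop_scalerAl linearZ.
- exact: state_ge0.
Qed.

Lemma state_le_diag a : cabs (phi a) ^+ 2 <= complex.Re (phi (bop_adj a * a)).
Proof.
have := state_CauchySchwarz 1 a; rewrite bop_adj1 !mul1r.
by case: phiN => _ _ ->; rewrite mul1r.
Qed.

(** Normality yields some bound for [phi]; the Cauchy-Schwarz inequality
    [|phi b|^2 <= phi (b^* b)], iterated along [b_(k+1) = b_k^* b_k], then
    improves that bound to 1.  This replaces the square root of the positive
    operator [|a|^2 - a^* a]. *)
Lemma state_diag_le a : complex.Re (phi (bop_adj a * a)) <= rnorm a ^+ 2.
Proof.
case: (phiN) => phiP _ _; have [C [C0 phiC]] := predual_bounded phiP.
pose b k : A := iter k (fun c : A => bop_adj c * c) (bop_adj a * a).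
apply: (@ler_of_powers _ _ _ C) => [|k]; first exact: sqr_ge0.
have t0 : 0 <= complex.Re (phi (bop_adj a * a)) by have [] := ge0_complex (state_ge0 a).
have lower : complex.Re (phi (bop_adj a * a)) ^+ (2 ^ k) <= complex.Re (phi (b k)).
  elim: k => [|k IH]; first by rewrite expn0 expr1.
  rewrite expnSr exprM (le_trans (ler_sqr_nneg (exprn_ge0 _ t0) IH))//.
  apply: le_trans (state_le_diag (b k)).
  rewrite ler_sqr_nneg ?Re_le_nm//.
  by rewrite (le_trans _ IH)// exprn_ge0.
have upper : rnorm (b k) <= (rnorm a ^+ 2) ^+ (2 ^ k).
  elim: k {lower} => [|k IH]; first by rewrite expn0 expr1 rnorm_adjM.
  by rewrite (le_trans (rnorm_adjM _))// expnSr exprM ler_sqr_nneg// rnorm_ge0.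
apply: (le_trans lower); apply: (le_trans (Re_le_nm _)); apply: (le_trans (phiC _)).
by rewrite ler_wpM2l.
Qed.

Lemma state_le a : cabs (phi a) <= rnorm a.
Proof.
rewrite -(@ler_pXn2r _ 2) ?nnegrE ?rnorm_ge0//.
exact: le_trans (state_le_diag a) (state_diag_le a).
Qed.

Variable y : nat -> A.
Hypothesis y_sup : sup [set complex.Re (phi (bop_adj (y j) * y j)) | j in [set: nat]] = 1.

(** A supremum equal to 1 is not the default value 0, so the set is bounded. *)
Lemma state_y_le1 j : complex.Re (phi (bop_adj (y j) * y j)) <= 1.
Proof.
rewrite -y_sup; apply: ub_le_sup; last by exists j.
have [[]//|] := pselect (has_sup [set complex.Re (phi (bop_adj (y j) * y j)) | j in [set: nat]]).
by move=> /sup_out; rewrite y_sup => /eqP; rewrite oner_eq0.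
Qed.

(** Each term is at most [phi (x_j^* x_j)]; summing inside [phi] before taking
    norms gives the norm of the block of [x], with constant 1. *)
Lemma seminorm_block x (c : R) m n : 0 <= c ->
  (forall h, \sum_(m <= j < n) rnorm (x j h) ^+ 2 <= (c * rnorm h) ^+ 2) ->
  \sum_(m <= j < n) cabs (phi (bop_adj (y j) * x j)) ^+ 2 <= c ^+ 2.
Proof.
move=> c0 xc.
apply: (@le_trans _ _ (complex.Re (phi (\sum_(m <= j < n) bop_adj (x j) * x j)))).
  rewrite linear_sum Re_sum; apply: ler_sum => j _.
  apply: (le_trans (state_CauchySchwarz _ _)); rewrite ler_piMl ?state_y_le1//.
  by have [] := ge0_complex (state_ge0 (x j)).
apply: (le_trans (Re_le_nm _)); apply: (le_trans (state_le _)).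
apply: bop_le_form => [|h g]; first exact: sqr_ge0.
rewrite hdot_sum_adjM (_ : _ * _ * _ = (c * rnorm h) * (c * rnorm g)); last by ring.
by apply: sum_hdot_le; rewrite ?mulr_ge0 ?rnorm_ge0.
Qed.

Local Notation sqs x := (fun j => cabs (phi (bop_adj (y j) * x j)) ^+ 2).

Lemma seminorm_cvg x : l2 x -> cvgn (series (sqs x)).
Proof.
move=> x2; apply: nondecreasing_is_cvgn.
  apply/nondecreasing_seqP => k; rewrite /series/= big_nat_recr//= lerDl.
  exact: sqr_ge0.
exists (l2norm x ^+ 2) => _ [n _ <-]; rewrite /series/=.
apply: seminorm_block; first exact: l2norm_ge0.
by move=> h; exact: l2norm_sum.
Qed.

Lemma seminorm_le x (c : R) : l2 x -> 0 <= c ->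
  (forall n, \sum_(0 <= j < n) sqs x j <= c ^+ 2) -> seminorm phi y x <= c.
Proof.
move=> x2 c0 xc; rewrite -(ger0_norm c0) -sqrtr_sqr ler_wsqrtr//.
apply: limr_le; first exact: seminorm_cvg.
by apply: nearW => n; exact: xc.
Qed.

Lemma seminorm_sum_le x n : l2 x -> \sum_(0 <= j < n) sqs x j <= seminorm phi y x ^+ 2.
Proof.
move=> x2.
have le_lim k : \sum_(0 <= j < k) sqs x j <= limn (series (sqs x)).
  by apply: series_le_lim => [j|]; [exact: sqr_ge0|exact: seminorm_cvg].
rewrite sqr_sqrtr//; apply: le_trans (le_lim 0); by rewrite big_geq.
Qed.

Lemma seminorm_l2norm x : l2 x -> seminorm phi y x <= l2norm x.
Proof.
move=> x2; apply: seminorm_le => // [|n]; first exact: l2norm_ge0.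
by apply: seminorm_block => [|h]; [exact: l2norm_ge0|exact: l2norm_sum].
Qed.

Lemma seminormD x z : l2 x -> l2 z ->
  seminorm phi y (x + z) <= seminorm phi y x + seminorm phi y z.
Proof.
move=> x2 z2; apply: seminorm_le; first exact: l2D.
  by rewrite addr_ge0// sqrtr_ge0.
move=> n; apply: (@sum_Minkowski _ _ _ (fun j => cabs (phi (bop_adj (y j) * x j)))
   (fun j => cabs (phi (bop_adj (y j) * z j)))); rewrite ?sqrtr_ge0 ?seminorm_sum_le// => j.
by rewrite rnorm_ge0/= mulrDr linearD ler_rnormD.
Qed.

Lemma seminormB x z : seminorm phi y (x - z) = seminorm phi y (z - x).
Proof.
rewrite /seminorm; congr (Num.sqrt (limn (series _))); apply/funext => j.
by rewrite -[x - z]opprB mulrN linearN/= rnormN.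
Qed.

End NormalStates.

(** * Comparison of the measures of noncompactness *)

Lemma sup_nneg (R : realType) (S : set R) : (forall x, S x -> 0 <= x) -> 0 <= sup S.
Proof.
move=> S0; have [Ssup|/sup_out -> //] := pselect (has_sup S).
by have [x Sx] := Ssup.1; rewrite (le_trans (S0 _ Sx))// ub_le_sup//; exact: Ssup.2.
Qed.

Lemma sup_le_nneg (R : realType) (S : set R) (c : R) : 0 <= c ->
  (forall x, S x -> x <= c) -> sup S <= c.
Proof.
move=> c0 Sc; have [->|/set0P S0] := eqVneq S set0; first by rewrite sup0.
exact: ge_sup.
Qed.

Section Measures.
Context {R : realType} {H : hilbertType R}.
Local Notation A := (bop H).
Implicit Types (x y z : nat -> A) (E : set (nat -> A)) (p : (nat -> A) -> R).

Lemma seminormsP p : seminorms p ->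
  [/\ forall x, 0 <= p x, forall x, l2 x -> p x <= l2norm x,
      forall x z, l2 x -> l2 z -> p (x + z) <= p x + p z &
      forall x z, p (x - z) = p (z - x)].
Proof.
move=> [phi [y [phiN y1 ->]]]; split.
- by move=> x; exact: sqrtr_ge0.
- by move=> x x2; exact: seminorm_l2norm.
- by move=> x z x2 z2; exact: seminormD.
- by move=> x z; exact: seminormB.
Qed.

Lemma seminorm_triangle p x y z : seminorms p -> l2 x -> l2 y -> l2 z ->
  p (x - y) <= p (x - z) + p (z - y).
Proof.
move=> /seminormsP[_ _ pD _] x2 y2 z2.
have -> : x - y = (x - z) + (z - y) by rewrite addrA subrK.
by apply: pD; exact: l2B.
Qed.

Section BoundedSet.
Variables (E : set (nat -> A)) (K : R).
Hypotheses (E2 : E `<=` l2) (EK : forall x, E x -> l2norm x <= K) (K0 : 0 <= K).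
Variable p : (nat -> A) -> R.
Hypothesis pP : seminorms p.

Let kset := [set e : R | 0 < e /\ exists (n : nat) (S : 'I_n -> set (nat -> A)),
  E = \bigcup_i S i /\ forall i x' x'', S i x' -> S i x'' -> p (x' - x'') < e].
Let hset := [set e : R | 0 < e /\ exists (n : nat) (x : 'I_n -> nat -> A),
  (forall i, l2 (x i)) /\ E `<=` \bigcup_i [set z | l2 z /\ p (z - x i) < e]].

(** The sets defining the two infima are nonempty, so neither infimum is a
    default value. *)
Lemma kset_large e : 0 < e -> kset (2 * K + e).
Proof.
move=> e0; have [_ ple _ _] := seminormsP pP.
split; first by rewrite ltr_wpDl// mulr_ge0.
exists 1, (fun=> E); split=> [|_ x' x'' Ex' Ex''].
  by apply/seteqP; split=> [x Ex|x [i _]//]; exists ord0.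
apply: (@le_lt_trans _ _ (2 * K)); last by rewrite ltrDl.
apply: (le_trans (ple _ (l2B (E2 Ex') (E2 Ex'')))).
apply: (le_trans (ler_l2normB (E2 Ex') (E2 Ex''))).
by have := EK Ex'; have := EK Ex''; lra.
Qed.

Lemma hset_large e : 0 < e -> hset (K + e).
Proof.
move=> e0; have [_ ple _ _] := seminormsP pP.
split; first by rewrite ltr_wpDl.
exists 1, (fun=> 0); split=> [_|x Ex]; first exact: l2_0.
exists ord0 => //; split; first exact: E2.
rewrite subr0; apply: (le_lt_trans (ple _ (E2 Ex))).
by apply: (le_lt_trans (EK Ex)); rewrite ltrDl.
Qed.

Lemma kuratowski_ge0 : 0 <= kuratowski E p.
Proof.
apply: lb_le_inf; first by exists (2 * K + 1); exact: kset_large.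
by move=> e [/ltW].
Qed.

Lemma hausdorff_ge0 : 0 <= hausdorff E p.
Proof.
apply: lb_le_inf; first by exists (K + 1); exact: hset_large.
by move=> e [/ltW].
Qed.

Lemma istratescu_ge0 : 0 <= istratescu E p.
Proof.
by apply: sup_nneg => e [/ltW].
Qed.

Lemma kuratowski_le : kuratowski E p <= 2 * K.
Proof.
apply: epsilon_le => e e0; apply: ge_inf; last exact: kset_large.
by exists 0 => e' [/ltW].
Qed.

Lemma hausdorff_le : hausdorff E p <= K.
Proof.
apply: epsilon_le => e e0; apply: ge_inf; last exact: hset_large.
by exists 0 => e' [/ltW].
Qed.

(** Infinitely many points in finitely many pieces put two points in one
    piece. *)
Lemma separated_le_kuratowski (S : set (nat -> A)) (e : R) :
  S `<=` E -> infinite_set S ->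
  (forall x' x'', S x' -> S x'' -> x' <> x'' -> e <= p (x' - x'')) ->
  e <= kuratowski E p.
Proof.
move=> SE Sinf Ssep.
apply: lb_le_inf; first by exists (2 * K + 1); exact: kset_large.
move=> e' [e'0 [n [F [EF Fp]]]]; rewrite leNgt; apply/negP => e'e.
apply: Sinf; apply: (@sub_finite_set _ _ (\bigcup_(i in [set: 'I_n]) (S `&` F i))).
  by move=> x Sx; have := SE _ Sx; rewrite EF => -[i _ Fx]; exists i.
apply: bigcup_finite; first exact: finite_finset.
move=> i _; have [->|/set0P[x [Sx Fx]]] := eqVneq (S `&` F i) set0; first exact: finite_set0.
apply: (@sub_finite_set _ _ [set x]); last exact: finite_set1.
move=> z [Sz Fz] /=; apply: contrapT => zx.
have := Ssep _ _ Sz Sx zx; rewrite leNgt => /negP; apply.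
exact: lt_trans (Fp _ _ _ Fz Fx) e'e.
Qed.

Lemma istratescu_le_kuratowski : istratescu E p <= kuratowski E p.
Proof.
apply: sup_le_nneg kuratowski_ge0 _ => e [_ [S [SE Sinf Ssep]]].
exact: separated_le_kuratowski Sinf Ssep.
Qed.

Lemma separated_le_istratescu (S : set (nat -> A)) (e : R) : 0 < e ->
  S `<=` E -> infinite_set S ->
  (forall x' x'', S x' -> S x'' -> x' <> x'' -> e <= p (x' - x'')) ->
  e <= istratescu E p.
Proof.
move=> e0 SE Sinf Ssep; apply: ub_le_sup; last by split=> //; exists S.
exists (kuratowski E p) => e' [_ [S' [S'E S'inf S'sep]]].
exact: separated_le_kuratowski S'inf S'sep.
Qed.

Lemma kuratowski_le_hausdorff : kuratowski E p <= 2 * hausdorff E p.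
Proof.
rewrite mulrC -ler_pdivrMr//; apply: lb_le_inf; first by exists (K + 1); exact: hset_large.
move=> e [e0 [n [x [x2 Ex]]]]; rewrite ler_pdivrMr//; apply: ge_inf.
  by exists 0 => e' [/ltW].
split; first by rewrite mulr_gt0.
exists n, (fun i => E `&` [set z | l2 z /\ p (z - x i) < e]); split.
  apply/seteqP; split=> [z Ez|z [i _ [//]]].
  by have [i _ h] := Ex _ Ez; exists i.
move=> i x' x'' [_ [x'2 px']] [_ [x''2 px'']].
apply: (le_lt_trans (seminorm_triangle pP x'2 x''2 (x2 i))).
have [_ _ _ pB] := seminormsP pP.
rewrite [p (x i - x'')]pB; lra.
Qed.

End BoundedSet.

Local Notation measure := (set (nat -> A) -> ((nat -> A) -> R) -> R).

Lemma star_le (mu : measure) E (c : R) : 0 <= c ->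
  (forall p, seminorms p -> mu E p <= c) -> star mu E <= c.
Proof.
by move=> c0 muc; apply: sup_le_nneg => // _ [p pP <-]; exact: muc.
Qed.

Lemma star_ge (mu : measure) E p (c : R) :
  (forall q, seminorms q -> mu E q <= c) -> seminorms p -> mu E p <= star mu E.
Proof.
move=> muc pP; apply: ub_le_sup; last by exists p.
by exists c => _ [q qP <-]; exact: muc.
Qed.

Lemma star_ge0 (mu : measure) E :
  (forall q, seminorms q -> 0 <= mu E q) -> 0 <= star mu E.
Proof. by move=> mu0; apply: sup_nneg => _ [p pP <-]; exact: mu0. Qed.

Section BoundedStar.
Variables (E : set (nat -> A)) (K : R).
Hypotheses (E2 : E `<=` l2) (EK : forall x, E x -> l2norm x <= K) (K0 : 0 <= K).

Lemma star_istratescu_ge p : seminorms p -> istratescu E p <= star istratescu E.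
Proof.
apply: (@star_ge _ _ _ (2 * K)) => q qP.
exact: le_trans (istratescu_le_kuratowski E2 EK K0 qP) (kuratowski_le E2 EK K0 qP).
Qed.

Lemma star_istratescu_ge0 : 0 <= star istratescu E.
Proof. by apply: star_ge0 => q qP; exact: istratescu_ge0. Qed.

Lemma star_kuratowski_ge0 : 0 <= star kuratowski E.
Proof. by apply: star_ge0 => q qP; exact: kuratowski_ge0 EK K0 q qP. Qed.

Lemma star_hausdorff_ge0 : 0 <= star hausdorff E.
Proof. by apply: star_ge0 => q qP; exact: hausdorff_ge0 EK K0 q qP. Qed.

Lemma star_istratescu_le_kuratowski : star istratescu E <= star kuratowski E.
Proof.
apply: star_le => [|p pP]; first exact: star_kuratowski_ge0.
apply: (le_trans (istratescu_le_kuratowski E2 EK K0 pP)).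
by apply: (@star_ge _ _ _ (2 * K)) pP => q qP; exact: kuratowski_le EK K0 q qP.
Qed.

Lemma star_kuratowski_le_hausdorff : star kuratowski E <= 2 * star hausdorff E.
Proof.
apply: star_le => [|p pP]; first by rewrite mulr_ge0// star_hausdorff_ge0.
apply: (le_trans (kuratowski_le_hausdorff E2 EK K0 pP)); rewrite ler_pM2l//.
by apply: (@star_ge _ _ _ K) pP => q qP; exact: hausdorff_le EK K0 q qP.
Qed.

End BoundedStar.

End Measures.

(** * Adjointable operators and distance to free submodules *)

Section BoundedOnBall.
Context {R : realType} {H : hilbertType R}.
Local Notation A := (bop H).
Implicit Types (x y z : nat -> A) (T F : (nat -> A) -> nat -> A).

Lemma l2ball0 : l2ball (0 : nat -> A).
Proof. by split; [exact: l2_0|rewrite l2norm0]. Qed.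

Lemma opnorm_le F (c : R) : (forall x, l2ball x -> l2norm (F x) <= c) -> opnorm F <= c.
Proof.
move=> Fc; apply: ge_sup; first by exists (l2norm (F 0)), 0 => //; exact: l2ball0.
by move=> _ [x xB <-]; exact: Fc.
Qed.

(** A bound on the ball is required, since the supremum of an unbounded set is
    0. *)
Lemma opnorm_ge F (c : R) x : (forall x, l2ball x -> l2norm (F x) <= c) ->
  l2ball x -> l2norm (F x) <= opnorm F.
Proof.
move=> Fc xB; apply: ub_le_sup; last by exists x.
by exists c => _ [z zB <-]; exact: Fc.
Qed.

Lemma opnorm_ge0 F : 0 <= opnorm F.
Proof. by apply: sup_nneg => _ [x _ <-]; exact: l2norm_ge0. Qed.

Section Adjointable.
Variables T S : (nat -> A) -> nat -> A.
Hypothesis hT : adjointable T.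
Hypothesis hS : l2_adjoint T S.

Lemma adjointable_l2 x : l2 x -> l2 (T x).
Proof. by case: hT => + _ _ _ _; apply. Qed.

Lemma adjointable_ball_le : exists C : R, forall x, l2ball x -> l2norm (T x) <= C.
Proof.
case: hT => _ _ _ [C TC] _; exists `|C| => x [x2 x1].
apply: (le_trans (TC x x2)); rewrite (le_trans (ler_wpM2r (l2norm_ge0 x) (ler_norm C)))//.
by rewrite ler_piMr.
Qed.

Lemma l2norm_opnorm_ball x : l2ball x -> l2norm (T x) <= opnorm T.
Proof. by have [C TC] := adjointable_ball_le; exact: opnorm_ge TC. Qed.

Lemma adjointableZ (c : R[i]) x : l2 x -> T (c *: x) = c *: T x.
Proof.
by move=> x2; rewrite -!rscale_scalar; case: hT => _ _ -> .
Qed.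

Lemma l2norm_opnorm x : l2 x -> l2norm (T x) <= opnorm T * l2norm x.
Proof.
move=> x2; have [x0|x0] := eqVneq (l2norm x) 0.
  case: hT => _ _ _ [C /(_ x x2)]; rewrite x0 mulr0 => Tx0 _.
  by rewrite mulr0.
have nx : 0 < l2norm x by rewrite lt_def x0 l2norm_ge0.
pose t := ((l2norm x)^-1)%:C%C : R[i].
have tB : l2ball (t *: x).
  split; first exact: l2Z.
  rewrite (le_trans (l2normZ_le _ x2))// cabs_real ger0_norm ?invr_ge0 ?l2norm_ge0//.
  by rewrite mulVf.
have xE : x = (l2norm x)%:C%C *: (t *: x).
  by rewrite scalerA -complexrM mulfV// scale1r.
rewrite {1}xE adjointableZ; last by case: tB.
apply: (le_trans (l2normZ_le _ (adjointable_l2 _))); first by case: tB.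
by rewrite cabs_real ger0_norm ?l2norm_ge0// mulrC ler_wpM2r ?l2norm_ge0 ?l2norm_opnorm_ball.
Qed.

(** [|S z|^2 = |<T S z, z>| <= |T| |S z| |z|]. *)
Lemma l2norm_adjoint z : l2 z -> l2norm (S z) <= opnorm T * l2norm z.
Proof.
move=> z2; have [S2 TS] := hS; have Sz2 := S2 _ z2.
have [Sz0|Sz0] := eqVneq (l2norm (S z)) 0.
  by rewrite Sz0 mulr_ge0 ?opnorm_ge0 ?l2norm_ge0.
have Sz_gt0 : 0 < l2norm (S z) by rewrite lt_def Sz0 l2norm_ge0.
rewrite -(ler_pM2r Sz_gt0) -expr2 l2norm_sqr -TS//.
apply: (le_trans (rnorm_l2dot (adjointable_l2 Sz2) z2)).
by rewrite mulrAC ler_wpM2r ?l2norm_ge0// l2norm_opnorm.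
Qed.

End Adjointable.

(** ** The submodule of sequences supported on the first coordinates *)

Definition trunc_module n : set (nat -> A) := [set x | forall j, (n <= j)%N -> x j = 0].

Lemma trunc_module_trunc n x : trunc_module n (l2trunc n x).
Proof. by move=> j nj; rewrite /l2trunc ltnNge nj. Qed.

Lemma trunc_module_free n : free_fg (trunc_module n).
Proof.
split.
- split=> [x x0||x y x0 y0 j nj|x a x0 j nj].
  + exact: l2_finite x0.
  + by [].
  + by rewrite fctE x0// y0// addr0.
  + by rewrite /rscale x0// mul0r.
- move=> x x2 xM j nj; apply: rnorm0_eq0; apply/eqP; rewrite eq_le rnorm_ge0 andbT.
  apply: epsilon_le => e /xM[y yM /ltW xy].
  have := l2norm_le_coef j (l2B x2 (l2_finite yM)).
  by rewrite !fctE yM// subr0 add0r => /le_trans; apply.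
- pose u (a : 'I_n -> A) : nat -> A := fun j => if insub j is Some i then a i else 0.
  have uE a (i : 'I_n) : u a i = a i by rewrite /u valK.
  have u0 a j : (n <= j)%N -> u a j = 0 by move=> nj; rewrite /u insubF// ltnNge nj.
  have ext x y : trunc_module n x -> trunc_module n y ->
      (forall i : 'I_n, x i = y i) -> x = y.
    move=> x0 y0 xy; apply/funext => j; have [nj|jn] := leqP n j.
      by rewrite x0// y0.
    exact: (xy (Ordinal jn)).
  exists n, u; split.
  + split=> [a _ j|a b _ _ uab|x xM].
    * exact: u0.
    * by apply/funext => i; rewrite -(uE a) -(uE b) uab.
    * exists (fun i => x i) => //; apply: ext => // [j|i]; last by rewrite uE.
      exact: u0.
  + move=> a b; apply: ext => [j|j nj|i]; first exact: u0.
      by rewrite fctE !u0// addr0.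
    by rewrite uE !fctE !uE.
  + move=> a c; apply: ext => [j|j nj|i]; first exact: u0.
      by rewrite /rscale u0// mul0r.
    by rewrite /rscale !uE.
  + move=> a b; rewrite (@l2dot_finite _ _ n); last by move=> j; exact: u0.
    by rewrite big_mkord; apply: eq_bigr => i _; rewrite !uE.
Qed.

(** ** Distances *)

Lemma lambda_set_near T (M : set (nat -> A)) (K e : R) : free_fg M ->
  (forall x, l2ball x -> l2 (T x) /\ l2norm (T x) <= K) ->
  sup [set inf [set l2norm (x - y) | y in M] | x in T @` l2ball] < e ->
  forall x, l2ball x -> exists2 y, M y & l2norm (T x - y) < e.
Proof.
move=> [[M2 M0 _ _] _ _] TK supe x xB.
have lb (v : nat -> A) : has_inf [set l2norm (v - y) | y in M].
  split; first by exists (l2norm (v - 0)), 0.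
  by exists 0 => _ [y _ <-]; exact: l2norm_ge0.
have infe : inf [set l2norm (T x - y) | y in M] < e.
  apply: le_lt_trans supe; apply: ub_le_sup; last by exists (T x) => //; exists x.
  exists K => _ [_ [z zB <-] <-]; have [Tz2 TzK] := TK _ zB.
  apply: le_trans TzK; apply: ge_inf; first exact: (lb _).2.
  by exists 0 => //; rewrite subr0.
move: infe; rewrite -subr_gt0 => e0.
have [_ [y yM <-]] := inf_adherent e0 (lb (T x)).
by rewrite subrKC => ye; exists y.
Qed.

Lemma near_lambda_set T (M : set (nat -> A)) (d : R) :
  (forall x, l2ball x -> exists2 y, M y & l2norm (T x - y) <= d) ->
  sup [set inf [set l2norm (x - y) | y in M] | x in T @` l2ball] <= d.
Proof.
move=> Td; apply: ge_sup.
  by exists (inf [set l2norm (T 0 - y) | y in M]), (T 0) => //; exists 0 => //; exact: l2ball0.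
move=> _ [_ [x xB <-] <-]; have [y yM yd] := Td _ xB.
apply: le_trans yd; apply: ge_inf; last by exists y.
by exists 0 => _ [z _ <-]; exact: l2norm_ge0.
Qed.

Lemma lambda0_ge0 T : 0 <= lambda0 T.
Proof.
have [Sne|Sne] := pselect (has_inf [set e : R | 0 < e /\ exists2 M, free_fg M &
    sup [set inf [set l2norm (x - y) | y in M] | x in T @` l2ball] < e]).
  by apply: lb_le_inf; [exact: Sne.1|move=> e [/ltW]].
by rewrite /lambda0 /lambda inf_out.
Qed.

(** A tail of [T x] is its difference with an element of the free submodule of
    the sequences supported on the first [n] coordinates. *)
Lemma lambda0_le T n (d : R) : 0 <= d ->
  (forall x, l2ball x -> l2norm (l2tail n (T x)) <= d) -> lambda0 T <= d.
Proof.
move=> d0 Td; apply: epsilon_le => e e0; apply: ge_inf.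
  by exists 0 => e' [/ltW].
split; first by rewrite ltr_wpDl.
exists (trunc_module n); first exact: trunc_module_free.
apply: (@le_lt_trans _ _ d); last by rewrite ltrDl.
apply: near_lambda_set => x xB; exists (l2trunc n (T x)).
  exact: trunc_module_trunc.
by rewrite {1}(l2trunc_tail n (T x)) addrAC subrr add0r Td.
Qed.

End BoundedOnBall.

(** * Bounded parts of free submodules are totally bounded *)

(** Cut the box [[-B, B]^I] into cells of side [d], and choose a point of [D]
    in each cell that contains the image of one. *)
Lemma bounded_family_net (R : realType) (Y : Type) (y0 : Y) (D : set Y)
    (I : finType) (f : I -> Y -> R) (B d : R) : 0 < d -> D y0 ->
  (forall i y, D y -> `|f i y| <= B) ->
  exists (n : nat) (c : 'I_n -> Y), (forall i, D (c i)) /\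
    forall y, D y -> exists i, forall k, `|f k y - f k (c i)| <= d.
Proof.
move=> d0 Dy0 fB; pose L := Num.truncn (2 * B / d).
pose t k y := Num.truncn ((f k y + B) / d).
pose cell y : {ffun I -> 'I_L.+1} := [ffun k => inord (t k y)].
have fB0 k y : D y -> 0 <= (f k y + B) / d.
  move=> Dy; rewrite divr_ge0 ?(ltW d0)//.
  by have := fB k _ Dy; rewrite ler_norml => /andP[]; lra.
have tL k y : D y -> (t k y < L.+1)%N.
  move=> Dy; rewrite ltnS le_truncn// ler_pM2r ?invr_gt0//.
  by have := fB k _ Dy; rewrite ler_norml => /andP[]; lra.
have cellP y y' k : D y -> D y' -> cell y = cell y' -> `|f k y - f k y'| <= d.
  move=> Dy Dy' /(congr1 (fun g : {ffun I -> 'I_L.+1} => nat_of_ord (g k))).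
  rewrite /cell !ffunE !inordK ?tL// => tt.
  have /andP[a1 a2] := truncn_itv (fB0 k _ Dy).
  have /andP[b1 b2] := truncn_itv (fB0 k _ Dy').
  move: a1 a2 b1 b2; rewrite -/(t k y) -/(t k y') tt.
  rewrite !ler_pdivlMr// !ltr_pdivrMr// -natr1 ler_norml => *.
  by apply/andP; split; lra.
have /choice[pt ptP] (g : {ffun I -> 'I_L.+1}) : exists y, D y /\
    forall y', D y' -> cell y' = g -> cell y = g.
  have [[y [Dy yg]]|none] := pselect (exists y, D y /\ cell y = g).
    by exists y; split.
  by exists y0; split=> // y' Dy' y'g; case: none; exists y'.
exists #|{ffun I -> 'I_L.+1}|, (fun i => pt (enum_val i)); split=> [i|y Dy].
  exact: (ptP _).1.
exists (enum_rank (cell y)) => k; rewrite enum_rankK.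
have [Dpt cellpt] := ptP (cell y).
by apply: cellP => //; rewrite (cellpt y).
Qed.

Section FreeModules.
Context {R : realType} {H : hilbertType R}.
Local Notation A := (bop H).
Implicit Types (x y z : nat -> A).

Lemma cabs_le_ReIm (z : R[i]) : cabs z <= `|complex.Re z| + `|complex.Im z|.
Proof.
rewrite -(@ler_pXn2r _ 2)// ?nnegrE ?rnorm_ge0 ?addr_ge0// cabs_sqr.
rewrite sqrrD !real_normK ?num_real// addrAC lerDl mulrn_wge0// mulr_ge0//.
Qed.

Lemma l2tailD N x y : l2tail N (x + y) = l2tail N x + l2tail N y.
Proof. by apply/funext => j; rewrite !fctE /l2tail; case: ifP => _; rewrite ?addr0. Qed.

Lemma l2tailB N x y : l2tail N (x - y) = l2tail N x - l2tail N y.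
Proof. by apply/funext => j; rewrite !fctE /l2tail; case: ifP => _; rewrite ?subr0. Qed.

Lemma l2tail_sum (I : Type) (r : seq I) (F : I -> nat -> A) N :
  l2tail N (\sum_(i <- r) F i) = \sum_(i <- r) l2tail N (F i).
Proof.
elim: r => [|i r IH]; last by rewrite !big_cons l2tailD IH.
by rewrite !big_nil; apply/funext => j; rewrite /l2tail; case: ifP.
Qed.

Lemma l2tail_rscale N x (a : A) : l2tail N (rscale x a) = rscale (l2tail N x) a.
Proof.
by apply/funext => j; rewrite /rscale /l2tail; case: ifP => //; rewrite mul0r.
Qed.

Lemma hilbert_module_iso_span n M (u : ('I_n -> A) -> nat -> A) :
  hilbert_module_iso M u -> forall a,
  u a = \sum_(i < n) rscale (u (fun k => if k == i then 1 else 0)) (a i).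
Proof.
move=> [_ uD uZ _] a.
have u0 : u 0 = 0 by apply: (@addrI _ (u 0)); rewrite -uD !addr0.
have uS (r : seq 'I_n) (F : 'I_n -> 'I_n -> A) :
    u (\sum_(i <- r) F i) = \sum_(i <- r) u (F i).
  by elim: r => [|i r IH]; rewrite ?big_nil// !big_cons uD IH.
under eq_bigr do rewrite -uZ; rewrite -uS; congr u; apply/funext => k.
rewrite fct_sumE (bigD1 k)//= /rscale eqxx mul1r big1 ?addr0// => i ik.
by rewrite eq_sym (negbTE ik) mul0r.
Qed.

(** The isometry turns [|u a|^2] into the norm of [\sum_i a_i^* a_i], which
    dominates each of its positive terms. *)
Lemma hilbert_module_iso_coef n M (u : ('I_n -> A) -> nat -> A) :
  hilbert_module_iso M u -> forall a i, rnorm (a i) <= l2norm (u a).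
Proof.
move=> [_ _ _ uu] a i; apply/(bop_leP _ (l2norm_ge0 _)) => h.
rewrite -(@ler_pXn2r _ 2) ?nnegrE ?mulr_ge0 ?rnorm_ge0 ?l2norm_ge0//.
rewrite exprMn l2norm_sqr uu.
apply: (@le_trans _ _ (complex.Re (hdot ((\sum_(i < n) bop_adj (a i) * a i : A) h) h))).
  rewrite bop_sumE hdot_suml Re_sum (bigD1 i)//= hdot_adjM hdotxx/= lerDl.
  by apply: sumr_ge0 => k _; rewrite hdot_adjM hdotxx/= sqr_ge0.
apply: (le_trans (Re_le_nm _)); apply: (le_trans (hdot_CauchySchwarz _ _)).
by rewrite [rnorm h ^+ 2]expr2 mulrA ler_wpM2r ?rnorm_ge0// bop_le.
Qed.

(** A bounded element of a free finitely generated submodule is a combination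
    of finitely many generators with bounded coefficients, so its tails are as
    small as those of the generators. *)
Lemma free_fg_tail M (K e : R) : free_fg M -> 0 <= K -> 0 < e ->
  exists N, forall y, M y -> l2norm y <= K -> l2norm (l2tail N y) <= e.
Proof.
move=> [[M2 _ _ _] _ [n [u uM]]] K0 e0.
have [[u_in _ u_onto] _ _ _] := uM.
pose b i := u (fun k => if k == i then 1 else 0).
have b2 i : l2 (b i) by apply: M2; exact: u_in.
have nK : 0 < n%:R * K + 1 by rewrite ltr_wpDl// mulr_ge0.
have e'0 : 0 < e / (n%:R * K + 1) by rewrite divr_gt0.
have /choice[N NP] i := l2norm_tail_small (b2 i) e'0.
exists (\max_(i < n) N i)%N => _ /u_onto[a _ <-] aK.
set N0 := (\max_(i < n) _)%N.
rewrite (hilbert_module_iso_span uM) l2tail_sum.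
have t2 i : l2 (l2tail N0 (rscale (b i) (a i))) by apply/l2_tail/l2_rscale/b2.
apply: (le_trans (proj2 (l2_sum _ t2))).
apply: (@le_trans _ _ (\sum_(i < n) e / (n%:R * K + 1) * K)).
  apply: ler_sum => i _; rewrite l2tail_rscale.
  apply: (le_trans (l2norm_rscale _ (l2_tail N0 (b2 i)))).
  rewrite ler_pM ?l2norm_ge0 ?rnorm_ge0//.
    by apply: NP; exact: leq_bigmax.
  exact: le_trans (hilbert_module_iso_coef uM a i) aK.
rewrite sumr_const card_ord -[leLHS]mulr_natl.
have -> : n%:R * (e / (n%:R * K + 1) * K) = e * (n%:R * K) / (n%:R * K + 1).
  by field; rewrite gt_eqF.
by rewrite ler_pdivrMr// ler_wpM2l ?(ltW e0)// lerDl.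
Qed.

(** After the tails are discarded, [p] depends on finitely many complex numbers
    [phi (v_j^* y_j)], which are bounded by the norm of [y]; a net for their
    real and imaginary parts is a net for [p]. *)
Lemma free_fg_totally_bounded M p (K d : R) : free_fg M -> seminorms p ->
  0 <= K -> 0 < d ->
  exists (n : nat) (c : 'I_n -> nat -> A), (forall i, l2 (c i)) /\
    forall y, M y -> l2norm y <= K -> exists i, p (y - c i) < d.
Proof.
move=> Mfree pP K0 d0; have [[M2 M0 _ _] _ _] := Mfree.
have d8 : 0 < d / 8 by rewrite divr_gt0.
have [N NP] := free_fg_tail Mfree K0 d8.
have [phi [v [phiN v1 pE]]] := pP.
have [_ ple pD _] := seminormsP pP.
pose co j (y : nat -> A) := phi (bop_adj (v j) * y j).
pose f (k : 'I_N * bool) y := if k.2 then complex.Re (co k.1 y) else complex.Im (co k.1 y).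
pose D := [set y | M y /\ l2norm y <= K].
have co_le j y : D y -> cabs (co j y) <= K.
  move=> [yM yK]; have y2 := M2 _ yM; apply: le_trans yK.
  rewrite -(@ler_pXn2r _ 2) ?nnegrE ?rnorm_ge0 ?l2norm_ge0//.
  have := seminorm_block phiN v1 (l2norm_ge0 y) (fun h => l2norm_sum h j j.+1 y2).
  by rewrite big_nat1.
have fK k y : D y -> `|f k y| <= K.
  move=> Dy; apply: le_trans (co_le k.1 _ Dy); rewrite /f.
  by case: ifP => _; [exact: cabs_ler_Re|exact: cabs_ler_Im].
have N1 : 0 < N%:R + 1 :> R by rewrite ltr_wpDl.
(* Real and imaginary parts within [e] give coordinates within [2 e]; the [N]
   coordinates together contribute at most [d / 4], as do the tails. *)
pose e := d / 8 / (N%:R + 1).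
have e0 : 0 < e by rewrite divr_gt0.
have D0 : D 0 by split; rewrite ?l2norm0.
have [n [c [cD cP]]] := bounded_family_net e0 D0 fK.
exists n, c; split=> [i|y yM yK]; first exact: M2 (cD i).1.
have [i ci] := cP _ (conj yM yK); exists i.
have [ciM ciK] := cD i; have y2 := M2 _ yM; have ci2 := M2 _ ciM.
rewrite (l2trunc_tail N (y - c i)).
apply: (le_lt_trans (pD _ _ (l2_trunc _ _) (l2_tail _ (l2B y2 ci2)))).
have tail_le : p (l2tail N (y - c i)) <= d / 4.
  apply: (le_trans (ple _ (l2_tail _ (l2B y2 ci2)))); rewrite l2tailB.
  apply: (le_trans (ler_l2normB (l2_tail _ y2) (l2_tail _ ci2))).
  by have := NP _ yM yK; have := NP _ ciM ciK; lra.
have co_e j : (j < N)%N -> cabs (co j (y - c i)) <= 2 * e.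
  move=> jN; have := ci (Ordinal jN, true); have := ci (Ordinal jN, false).
  rewrite /f/= => h1 h2; apply: (le_trans (cabs_le_ReIm _)).
  have -> : co j (y - c i) = co j y - co j (c i) by rewrite /co mulrBr linearB.
  by rewrite ReD ReN ImD (_ : complex.Im (- _) = - complex.Im (co j (c i))) ?mulr2n;
    [lra|case: (co j (c i))].
have trunc_le : p (l2trunc N (y - c i)) <= d / 4.
  have dE : d / 4 = 2 * e * (N%:R + 1) by rewrite /e; field; rewrite gt_eqF.
  rewrite dE pE; apply: (seminorm_le phiN v1); first exact: l2_trunc.
    by rewrite mulr_ge0 ?(ltW N1)// mulr_ge0// (ltW e0).
  move=> k; pose F j := cabs (phi (bop_adj (v j) * l2trunc N (y - c i) j)) ^+ 2.
  rewrite -[leLHS]/(\sum_(0 <= j < k) F j).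
  have F0 j : (N <= j)%N -> F j = 0.
    by move=> Nj; rewrite /F /l2trunc ltnNge Nj mulr0 linear0 rnorm0 expr0n.
  have Fpos j : 0 <= F j by exact: sqr_ge0.
  apply: (@le_trans _ _ (\sum_(0 <= j < N) F j)).
    have [kN|/ltnW Nk] := leqP k N.
      by rewrite (big_cat_nat (leq0n k) kN)/= lerDl sumr_ge0.
    rewrite (big_cat_nat (leq0n N) Nk)/= [X in _ + X](_ : _ = 0) ?addr0//.
    by rewrite big_nat big1// => j /andP[Nj _]; exact: F0.
  apply: (@le_trans _ _ (\sum_(0 <= j < N) (2 * e) ^+ 2)).
    rewrite !big_nat; apply: ler_sum => j /= jN; rewrite /F /l2trunc jN.
    by rewrite ler_sqr_nneg ?rnorm_ge0// co_e.
  rewrite sumr_const_nat subn0 -[leLHS]mulr_natl [leRHS]exprMn [leLHS]mulrC.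
  rewrite ler_wpM2l ?sqr_ge0//; move: (ler0n R N); move: (N%:R) => q; nra.
lra.
Qed.

(** Balls around the centres of a net of a bounded part of [M] cover whatever
    is uniformly close to [M], since [p] is dominated by the norm. *)
Lemma hausdorff_le_near_free (E : set (nat -> A)) M p (K e : R) :
  E `<=` l2 -> (forall x, E x -> l2norm x <= K) -> 0 <= K ->
  free_fg M -> seminorms p -> 0 < e ->
  (forall x, E x -> exists2 y, M y & l2norm (x - y) < e) ->
  hausdorff E p <= e.
Proof.
move=> E2 EK K0 Mfree pP e0 Enear; apply: epsilon_le => d d0.
have [_ ple _ _] := seminormsP pP; have [[M2 _ _ _] _ _] := Mfree.
have [n [c [c2 cP]]] := free_fg_totally_bounded Mfree pP (addr_ge0 K0 (ltW e0)) d0.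
apply: ge_inf; first by exists 0 => e' [/ltW].
split; first exact: addr_gt0.
exists n, c; split=> // x Ex; have [y yM xy] := Enear _ Ex.
have x2 := E2 _ Ex; have y2 := M2 _ yM.
have yK : l2norm y <= K + e.
  have -> : y = x - (x - y) by rewrite opprB addrC subrK.
  by rewrite (le_trans (ler_l2normB x2 (l2B x2 y2)))// lerD ?EK// ltW.
have [i yc] := cP _ yM yK; exists i => //; split=> //.
apply: (le_lt_trans (seminorm_triangle pP x2 (c2 i) y2)).
by rewrite ltrD// (le_lt_trans _ xy)// ple//; exact: l2B.
Qed.

End FreeModules.

(** * Separated sequences from non-vanishing tails *)

Section VectorState.
Context {R : realType} {H : hilbertType R}.
Local Notation A := (bop H).
Variable h0 : H.

(** For this state, [p] only sees the vectors [x j h0], and the sequence [y] only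
    enters through the vectors [y j h0], which can be any unit vectors. *)
Definition vector_state (a : A) : R[i] := hdot (a h0) h0.

Fact vector_state_is_scalar : scalar vector_state.
Proof. by move=> c a b; rewrite /vector_state bopDE bopZE hdotPl. Qed.

HB.instance Definition _ :=
  GRing.isLinear.Build R[i] A R[i] _ vector_state vector_state_is_scalar.

Hypothesis h01 : rnorm h0 = 1.

Lemma vector_state_normal : normal_state (vector_state : {scalar A}).
Proof.
pose xi n : H := if n is 0 then h0 else 0.
have cvg_xi : cvgn (series (fun n => rnorm (xi n) ^+ 2)).
  apply/cvg_ex; exists 1; apply: cvg_near_cst; exists 1 => // n /= n1.
  rewrite /series/= -[n]prednK// big_nat_recl//= h01 expr1n big1 ?addr0// => j _.
  by rewrite rnorm0 expr0n.
split=> [|a|].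
- exists xi, xi; split=> // a.
  apply: cvg_near_cst; exists 1 => // n /= n1.
  rewrite /series/= -[n]prednK// big_nat_recl//= big1 ?addr0// => j _.
  by rewrite hdot0r.
- by rewrite /= /vector_state hdot_adjM hdotxx ler0c sqr_ge0.
- by rewrite /= /vector_state bop1E hdotxx h01 expr1n.
Qed.

Variable v : nat -> H.
Hypothesis v1 : forall j, rnorm (v j) = 1.

Lemma vector_state_ket_bra j (a : A) :
  vector_state (bop_adj (ket_bra (v j) h0) * a) = hdot (a h0) (v j).
Proof.
by rewrite /vector_state hdot_adjM ket_braE hdotxx h01 expr1n scale1r.
Qed.

Lemma vector_state_sup : sup [set complex.Re ((vector_state : {scalar A})
  (bop_adj (ket_bra (v j) h0) * ket_bra (v j) h0)) | j in [set: nat]] = 1.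
Proof.
rewrite (_ : [set _ | _ in _] = [set 1]) ?sup1//.
have val j : complex.Re (vector_state (bop_adj (ket_bra (v j) h0) * ket_bra (v j) h0)) = 1.
  rewrite vector_state_ket_bra ket_braE !hdotxx/= h01 expr1n scale1r.
  by rewrite hdotxx/= v1 expr1n.
by apply/seteqP; split=> [_ [j _ <-]|_ ->] /=; [exact: val|exists 0].
Qed.

Lemma seminorms_vector :
  seminorms (seminorm (vector_state : {scalar A}) (fun j => ket_bra (v j) h0)).
Proof.
exists (vector_state : {scalar A}), (fun j => ket_bra (v j) h0); split=> //.
  exact: vector_state_normal.
exact: vector_state_sup.
Qed.

(** Cauchy-Schwarz against the square-summable sequence [rnorm (zeta j)]: the
    semi-norm detects every vector whose coordinates point along the [v j]. *)
Lemma seminorm_vector_ge (x : nat -> A) (zeta : nat -> H) m : l2 x ->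
  (forall j, zeta j = (rnorm (zeta j))%:C%C *: v j) ->
  \sum_(0 <= j < m) rnorm (zeta j) ^+ 2 <= 1 ->
  cabs (\sum_(0 <= j < m) hdot (zeta j) (x j h0)) <=
  seminorm (vector_state : {scalar A}) (fun j => ket_bra (v j) h0) x.
Proof.
move=> x2 zv z1; set p := seminorm _ _ x.
have p0 : 0 <= p by exact: sqrtr_ge0.
pose a j := cabs (vector_state (bop_adj (ket_bra (v j) h0) * x j)).
apply: (@le_trans _ _ (\sum_(0 <= j < m) rnorm (zeta j) * a j)).
  apply: (le_trans (@rnorm_sum _ R[i]^o _ _ _)); apply: ler_sum => j _.
  rewrite zv hdotZl cabsM cabs_real ger0_norm ?rnorm_ge0//.
  by rewrite /a vector_state_ket_bra [hdot (v j) _]hdotC cabs_conj -zv.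
rewrite -(@ler_pXn2r _ 2)//; last first.
  by rewrite nnegrE sumr_ge0// => j _; rewrite mulr_ge0 ?rnorm_ge0.
apply: le_trans (sum_CauchySchwarz _ _ _) _; rewrite -[leRHS]mul1r.
rewrite ler_pM ?sumr_ge0// => [j _|j _|]; rewrite ?sqr_ge0//.
exact: (seminorm_sum_le vector_state_normal vector_state_sup).
Qed.

End VectorState.

Section SeparatedSequence.
Context {R : realType} {H : hilbertType R}.
Local Notation A := (bop H).
Variables T S : (nat -> A) -> nat -> A.
Hypotheses (hT : adjointable T) (hS : l2_adjoint T S).
Implicit Types (x y z : nat -> A).

Lemma exists_unit_vector x : l2 x -> 0 < l2norm x -> exists h : H, rnorm h = 1.
Proof.
move=> x2 x0; have [[h h0]|triv] := pselect (exists h : H, h != 0).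
  exists ((rnorm h)^-1%:C%C *: h).
  by rewrite rnorm_realZ ger0_norm ?invr_ge0 ?rnorm_ge0// mulVf// gt_eqF// rnorm_gt0.
move: x0; rewrite ltNge => /negP[]; apply/(l2norm_leP x2) => // h n.
have all0 (k : H) : k = 0 by apply: contrapT => /eqP k0; apply: triv; exists k.
by rewrite big1 ?sqr_ge0// => j _; rewrite (all0 (x j h)) rnorm0 expr0n.
Qed.

(** This embeds the finitely supported part of the unit ball of l^2(H) into that
    of l^2(A). *)
Lemma l2_ket_bra (zeta : nat -> H) (h0 : H) m : rnorm h0 = 1 ->
  (forall j, (m <= j)%N -> zeta j = 0) ->
  \sum_(0 <= j < m) rnorm (zeta j) ^+ 2 <= 1 ->
  l2ball (fun j => ket_bra (zeta j) h0).
Proof.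
move=> h01 z0 z1.
have kb0 j : (m <= j)%N -> ket_bra (zeta j) h0 = 0.
  by move=> mj; apply: bopP => h; rewrite ket_braE z0// scaler0.
have z2 : l2 (fun j => ket_bra (zeta j) h0) by exact: l2_finite kb0.
split=> //; apply/(l2norm_leP z2) => // h n.
rewrite mul1r (eq_bigr (fun j => cabs (hdot h h0) ^+ 2 * rnorm (zeta j) ^+ 2)); last first.
  by move=> j _; rewrite ket_braE rnormZ exprMn.
rewrite -mulr_sumr -[leRHS]mulr1 ler_pM ?sqr_ge0//.
- by apply: sumr_ge0 => j _; exact: sqr_ge0.
- rewrite ler_sqr_nneg ?rnorm_ge0// -[leRHS]mulr1 -h01.
  exact: hdot_CauchySchwarz.
- apply: le_trans z1; have [nm'|/ltnW mn] := leqP n m.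
    rewrite (big_cat_nat (leq0n n) nm')/= lerDl.
    by apply: sumr_ge0 => j _; exact: sqr_ge0.
  rewrite (big_cat_nat (leq0n m) mn)/= [X in _ + X](_ : _ = 0) ?addr0//.
  by rewrite big_nat big1// => j /andP[mj _]; rewrite z0// rnorm0 expr0n.
Qed.

(** If [T x] has a tail of norm above [c], normalizing a finite piece of that
    tail at a suitable vector gives a finitely supported [zeta] of norm at most
    1 on which the adjoint is bounded below:
    [|S zeta| >= <S zeta, x> = <zeta, T x> >= c]. *)
Lemma tail_test_vector (h0 : H) n (c : R) x : rnorm h0 = 1 -> 0 <= c ->
  l2ball x -> c < l2norm (l2tail n (T x)) ->
  exists (m : nat) (zeta : nat -> H),
    [/\ forall j, (j < n)%N -> zeta j = 0, forall j, (m <= j)%N -> zeta j = 0,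
        \sum_(0 <= j < m) rnorm (zeta j) ^+ 2 <= 1 &
        let z := fun j => ket_bra (zeta j) h0 in
        c ^+ 2 <= complex.Re (hdot (l2dot (S z) (S z) h0) h0)].
Proof.
move=> h01 c0 [x2 x1] cx; have Tx2 := adjointable_l2 hT x2.
have [h [m hm]] : exists h m, (c * rnorm h) ^+ 2 <
    \sum_(0 <= j < m) rnorm (l2tail n (T x) j h) ^+ 2.
  apply: contrapT => none; move: cx; rewrite ltNge => /negP; apply.
  apply/(l2norm_leP (l2_tail n Tx2) c0) => h m; rewrite leNgt; apply/negP => lt.
  by apply: none; exists h, m.
set Q := \sum_(0 <= j < m) _ in hm.
have ch0 : 0 <= c * rnorm h by rewrite mulr_ge0 ?rnorm_ge0.
have Q0 : 0 < Q by apply: le_lt_trans hm; exact: sqr_ge0.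
pose s := Num.sqrt Q; have s0 : 0 < s by rewrite sqrtr_gt0.
have sQ : s ^+ 2 = Q by rewrite sqr_sqrtr// ltW.
have cs : c * rnorm h < s.
  by rewrite -(ger0_norm ch0) -sqrtr_sqr ltr_sqrt.
(* Cauchy-Schwarz is an equality against the normalized piece itself. *)
pose zeta j : H := if (j < m)%N then (s^-1)%:C%C *: l2tail n (T x) j h else 0.
have zm j : (m <= j)%N -> zeta j = 0 by move=> mj; rewrite /zeta ltnNge mj.
have zn j : (j < n)%N -> zeta j = 0.
  by move=> jn; rewrite /zeta /l2tail jn scaler0 if_same.
have z1 : \sum_(0 <= j < m) rnorm (zeta j) ^+ 2 = 1.
  transitivity (\sum_(0 <= j < m) (s^-1) ^+ 2 * rnorm (l2tail n (T x) j h) ^+ 2).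
    rewrite !big_nat; apply: eq_bigr => j /= jm.
    by rewrite /zeta jm rnorm_realZ ger0_norm ?invr_ge0 ?(ltW s0)// exprMn.
  by rewrite -mulr_sumr -/Q -sQ exprVn mulVf// sqrf_eq0 gt_eqF.
exists m, zeta; split; rewrite ?z1// => z.
have [z2 _] : l2ball z by apply: (l2_ket_bra h01 zm); rewrite z1.
have [S2 TS] := hS; have Sz2 := S2 _ z2.
have z0 j : (m <= j)%N -> z j = 0.
  by move=> mj; apply: bopP => g; rewrite /z ket_braE zm// scaler0.
set P := complex.Re _.
have P0 : 0 <= P by have := sum_le_l2dot_diag h0 0 0 Sz2; rewrite big_geq.
have pair : hdot (l2dot (T x) z h0) h = s%:C%C.
  rewrite (l2dot_finite _ z0) hdot_sum_adjM.
  transitivity (((s^-1 * Q)%:C)%C : R[i]); last by rewrite -sQ expr2 mulKf// gt_eqF.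
  rewrite /Q mulr_sumr (rmorph_sum (real_complex R))/= !big_nat.
  apply: eq_bigr => j /= jm; rewrite /z ket_braE hdotxx h01 expr1n scale1r.
  rewrite /zeta jm hdotZl complexrM; congr (_ * _); rewrite /l2tail.
  by case: ifP => _; rewrite ?bop0E ?hdot0l ?rnorm0 ?expr0n// hdotxx.
have sP : s <= Num.sqrt P * rnorm h.
  rewrite -(ger0_norm (ltW s0)) -cabs_real -pair TS//.
  apply: l2dot_form_le => //; rewrite ?sqrtr_ge0 ?rnorm_ge0// => k.
    by rewrite sqr_sqrtr//; exact: sum_le_l2dot_diag.
  apply: (le_trans (l2norm_sum h 0 k x2)).
  rewrite ler_sqr_nneg ?mulr_ge0 ?l2norm_ge0 ?rnorm_ge0//.
  by rewrite ler_piMl ?rnorm_ge0.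
have cP : c <= Num.sqrt P.
  have := lt_le_trans cs sP; rewrite leNgt => lt; apply/negP => Pc; move: lt.
  by rewrite ltNge => /negP; apply; rewrite ler_wpM2r ?rnorm_ge0// ltW.
by rewrite -(sqr_sqrtr P0) ler_sqr_nneg.
Qed.

(** Given a test vector beyond each [n], let [w n] be the image under [T] of
    the normalized [S (zeta n)].  It pairs with [zeta n] to at least
    [c^2 / |T|], whereas it pairs with every [zeta n'] supported far enough to
    at most [d].  Along a sparse sequence of indices the supports of the
    [zeta]'s are disjoint, so that one family of unit vectors [v j], hence one
    semi-norm, detects all of them. *)
Lemma separated_sequence (c d : R) : 0 <= c -> 0 < d ->
  0 < c ^+ 2 / opnorm T - d ->
  (forall n, exists2 x, l2ball x & c < l2norm (l2tail n (T x))) ->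
  exists2 p, seminorms p & c ^+ 2 / opnorm T - d <= istratescu (T @` l2ball) p.
Proof.
move=> c0 d0 cd tails; set t := opnorm T; set e := _ - d.
have TK x : l2ball x -> l2norm (T x) <= t by exact: l2norm_opnorm_ball.
have t0 : 0 < t.
  have [x [x2 x1] cx] := tails 0.
  apply: (le_lt_trans c0); apply: (lt_le_trans cx); apply: le_trans (TK _ (conj x2 x1)).
  apply: (proj2 (l2_dominated1 _ (adjointable_l2 hT x2))) => j h.
  by rewrite /l2tail ltn0.
have [h0 h01] : exists h : H, rnorm h = 1.
  have [x [x2 x1] cx] := tails 0; apply: (@exists_unit_vector (l2tail 0 (T x))).
    exact/l2_tail/(adjointable_l2 hT).
  exact: le_lt_trans cx.
have /choice[mz mzP] n : exists mz : nat * (nat -> H),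
    [/\ forall j, (j < n)%N -> mz.2 j = 0, forall j, (mz.1 <= j)%N -> mz.2 j = 0,
        \sum_(0 <= j < mz.1) rnorm (mz.2 j) ^+ 2 <= 1 &
        let z := fun j => ket_bra (mz.2 j) h0 in
        c ^+ 2 <= complex.Re (hdot (l2dot (S z) (S z) h0) h0)].
  have [x xB cx] := tails n.
  by have [m [zeta zP]] := tail_test_vector h01 c0 xB cx; exists (m, zeta).
pose m n := (mz n).1; pose zeta n := (mz n).2.
pose z n j := ket_bra (zeta n j) h0.
have zetalo n j : (j < n)%N -> zeta n j = 0 by have [+ _ _ _] := mzP n; apply.
have zetahi n j : (m n <= j)%N -> zeta n j = 0 by have [_ + _ _] := mzP n; apply.
have zeta1 n : \sum_(0 <= j < m n) rnorm (zeta n j) ^+ 2 <= 1 by have [_ _ + _] := mzP n.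
have zetaS n : c ^+ 2 <= complex.Re (hdot (l2dot (S (z n)) (S (z n)) h0) h0).
  by have [_ _ _ +] := mzP n.
have zB n : l2ball (z n) by exact: (l2_ket_bra h01 (zetahi n) (zeta1 n)).
have [S2 TS] := hS; have Sz2 n : l2 (S (z n)) by apply: S2; have [] := zB n.
pose y n := (t^-1)%:C%C *: S (z n).
have yB n : l2ball (y n).
  split; first exact: l2Z.
  apply: (le_trans (l2normZ_le _ (Sz2 n))).
  rewrite cabs_real ger0_norm ?invr_ge0 ?(ltW t0)// mulrC ler_pdivrMr// mul1r.
  have [z2 z1] := zB n; apply: (le_trans (l2norm_adjoint hT hS z2)).
  by rewrite ler_piMr// ltW.
pose w n := T (y n).
have w2 n : l2 (w n) by apply: (adjointable_l2 hT); have [] := yB n.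
have wE n : w n = (t^-1)%:C%C *: T (S (z n)) by exact: (adjointableZ hT).
have zh n j : z n j h0 = zeta n j by rewrite /z ket_braE hdotxx h01 expr1n scale1r.
have diag n : c ^+ 2 / t <=
    complex.Re (\sum_(0 <= j < m n) hdot (zeta n j) (w n j h0)).
  have z0 j : (m n <= j)%N -> z n j = 0.
    by move=> mj; apply: bopP => g; rewrite /z ket_braE zetahi// scaler0.
  have TSz : hdot (l2dot (T (S (z n))) (z n) h0) h0 =
      \sum_(0 <= j < m n) hdot (zeta n j) (T (S (z n)) j h0).
    rewrite (l2dot_finite _ z0) hdot_sum_adjM.
    by apply: eq_bigr => j _; rewrite zh.
  have z2 := (zB n).1.
  have := zetaS n; rewrite -TS// TSz !Re_sum => cle.
  rewrite mulrC (le_trans (ler_wpM2l _ cle)) ?invr_ge0 ?(ltW t0)// mulr_sumr.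
  apply: ler_sum => j _; rewrite wE bopZE hdotZr.
  have -> : ((t^-1)%:C%C : R[i])^* = (t^-1)%:C%C by exact: conjc_real.
  by move: (hdot _ _) => [a b]; simpc.
have /choice[N NP] n := l2norm_tail_small (w2 n) d0.
(* From the index [f n] on, [zeta n] vanishes and the tail of [w n] is at most
   [d]; iterating [f] from 0 selects the sparse indices. *)
pose f n := maxn n.+1 (maxn (m n) (N n)).
pose idx k := iter k f 0.
have f_le k l : (k < l)%N -> (f (idx k) <= idx l)%N.
  elim: l => // l IH; rewrite ltnS leq_eqVlt => /orP[/eqP -> //|/IH kl].
  by apply: (leq_trans kl); rewrite /= /f !leq_max leqnSn.
have disj k l j : zeta (idx k) j != 0 -> zeta (idx l) j != 0 -> k = l.
  wlog kl : k l / (k < l)%N.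
    by move=> W zk zl; have [kl|lk|//] := ltngtP k l; [exact: W|symmetry; exact: W].
  move=> zk zl; case/eqP: zl; apply: zetalo.
  apply: (@leq_trans (f (idx k))); last exact: f_le.
  have jm : (j < m (idx k))%N.
    by rewrite ltnNge; apply/negP => mj; case/eqP: zk; exact: zetahi.
  by rewrite /f !leq_max jm orbT.
have /choice[v vP] j : exists v : H, rnorm v = 1 /\
    forall k, zeta (idx k) j = (rnorm (zeta (idx k) j))%:C%C *: v.
  have [[k zk]|none] := pselect (exists k, zeta (idx k) j != 0).
    have nz : 0 < rnorm (zeta (idx k) j) by rewrite rnorm_gt0.
    exists ((rnorm (zeta (idx k) j))^-1%:C%C *: zeta (idx k) j); split=> [|l].
      by rewrite rnorm_realZ ger0_norm ?invr_ge0 ?rnorm_ge0// mulVf// gt_eqF.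
    have [->|zl] := eqVneq (zeta (idx l) j) 0; first by rewrite rnorm0 scale0r.
    by rewrite -(disj _ _ _ zk zl) scalerA -complexrM mulfV ?scale1r// gt_eqF.
  exists h0; split=> // l; have [->|zl] := eqVneq (zeta (idx l) j) 0.
    by rewrite rnorm0 scale0r.
  by case: none; exists l.
pose p := seminorm (vector_state h0 : {scalar A}) (fun j => ket_bra (v j) h0).
have v1 j : rnorm (v j) = 1 := (vP j).1.
have pP : seminorms p by exact: seminorms_vector.
(* The later of the two test vectors is used: it sees only a far tail of the
   earlier element. *)
have far k l : (k < l)%N -> e <= p (w (idx l) - w (idx k)).
  move=> kl; have test := seminorm_vector_ge h01 v1 (l2B (w2 (idx l)) (w2 (idx k)))
    (fun j => (vP j).2 l) (zeta1 (idx l)).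
  apply: le_trans test; apply: le_trans (Re_le_nm _).
  rewrite Re_sum (eq_bigr (fun j => complex.Re (hdot (zeta (idx l) j) (w (idx l) j h0))
     - complex.Re (hdot (zeta (idx l) j) (w (idx k) j h0)))); last first.
    by move=> j _; rewrite bopBE hdotBr ReD ReN.
  rewrite sumrB -!Re_sum lerB//.
  apply: (le_trans (Re_le_nm _)).
  rewrite (eq_bigr (fun j => hdot (z (idx l) j h0) (l2tail (idx l) (w (idx k)) j h0))); last first.
    move=> j _; rewrite zh /l2tail; case: ifP => // jl.
    by rewrite zetalo// !hdot0l.
  rewrite -[d]mul1r; apply: sum_hdot_le => //; first exact: ltW.
    by rewrite expr1n; under eq_bigr do rewrite zh.
  apply: (le_trans (l2norm_sum h0 0 (m (idx l)) (l2_tail (idx l) (w2 (idx k))))).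
  rewrite h01 mulr1 ler_sqr_nneg ?l2norm_ge0//; apply: NP.
  by apply: leq_trans (f_le _ _ kl); rewrite /f !leq_max leqnn !orbT.
have sep k l : k != l -> e <= p (w (idx k) - w (idx l)).
  rewrite neq_ltn => /orP[kl|lk]; last exact: far.
  by have [_ _ _ ->] := seminormsP pP; exact: far.
have winj : injective (fun k => w (idx k)).
  move=> k l /= wkl; apply/eqP/negPn/negP => /sep; rewrite wkl leNgt => /negP; apply.
  apply: le_lt_trans cd; rewrite subrr -(@l2norm0 R H).
  by have [_ ple _ _] := seminormsP pP; apply: ple; exact: l2_0.
exists p => //.
have E2 : T @` l2ball `<=` l2 by move=> _ [x [x2 _] <-]; exact: (adjointable_l2 hT).
have EK x : (T @` l2ball) x -> l2norm x <= t by move=> [u uB <-]; exact: TK.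
apply: (@separated_le_istratescu _ _ _ t E2 EK (ltW t0) _ pP [set w (idx k) | k in [set: nat]]) => //.
- by move=> _ [k _ <-]; exists (y (idx k)).
- move=> Sfin; apply: infinite_nat.
  have /sub_finite_set : [set: nat] `<=` (fun k => w (idx k)) @^-1`
      [set w (idx k) | k in [set: nat]] by move=> k _; exists k.
  by apply; apply: finite_preimage Sfin => k l _ _; exact: winj.
- move=> _ _ [k _ <-] [l _ <-] wkl; apply: sep; apply/eqP => kl.
  by apply: wkl; rewrite kl.
Qed.

End SeparatedSequence.

(** * Compact operators *)

Section Compactness.
Context {R : realType} {H : hilbertType R}.
Local Notation A := (bop H).
Implicit Types (x y z : nat -> A) (T S F : (nat -> A) -> nat -> A).

Lemma rank_one_tail n (c : R[i]) z y x : l2 z -> l2 y -> l2ball x ->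
  l2 (c *: rank_one z y x) /\
  l2norm (l2tail n (c *: rank_one z y x)) <= cabs c * l2norm y * l2norm (l2tail n z).
Proof.
move=> z2 y2 [x2 x1]; split; first exact/l2Z/l2_rscale.
have -> : l2tail n (c *: rank_one z y x) = c *: rscale (l2tail n z) (l2dot y x).
  rewrite -l2tail_rscale; apply/funext => j; rewrite /l2tail !fctE.
  by case: ifP => //; rewrite scaler0.
have zt2 := l2_tail n z2.
apply: (le_trans (l2normZ_le c (l2_rscale _ zt2))); rewrite -mulrA.
rewrite ler_wpM2l ?rnorm_ge0//; apply: (le_trans (l2norm_rscale _ zt2)).
rewrite mulrC ler_wpM2r ?l2norm_ge0//; apply: (le_trans (rnorm_l2dot y2 x2)).
by rewrite ler_piMr ?l2norm_ge0.
Qed.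

Lemma l2tail0 x : l2tail 0 x = x.
Proof. by apply/funext => j; rewrite /l2tail ltn0. Qed.

(** The tails of [F x] only involve those of the finitely many vectors that span
    the range of [F]; with [n = 0] this also bounds [F] on the ball. *)
Lemma finite_rank_tail F : finite_rank F ->
  exists2 k : nat -> R,
    forall n x, l2ball x -> l2 (F x) /\ l2norm (l2tail n (F x)) <= k n &
    forall e, 0 < e -> exists n, k n <= e.
Proof.
move=> [m [c [z [y [zy2 ->]]]]].
pose q i := cabs (c i) * l2norm (y i).
have q0 i : 0 <= q i by rewrite mulr_ge0 ?rnorm_ge0 ?l2norm_ge0.
exists (fun n => \sum_(i < m) q i * l2norm (l2tail n (z i))) => [n x xB|e e0].
  rewrite fct_sumE.
  have Fi i := rank_one_tail n (c i) (zy2 i).1 (zy2 i).2 xB.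
  split; first exact: (proj1 (l2_sum _ (fun i => (Fi i).1))).
  rewrite l2tail_sum.
  apply: (le_trans (proj2 (l2_sum _ (fun i => l2_tail n (Fi i).1)))).
  by apply: ler_sum => i _; exact: (Fi i).2.
have s1 : 0 < \sum_(i < m) q i + 1 by rewrite ltr_wpDl// sumr_ge0.
have /choice[N NP] i := l2norm_tail_small (zy2 i).1 (divr_gt0 e0 s1).
exists (\max_(i < m) N i)%N.
apply: (@le_trans _ _ (\sum_(i < m) q i * (e / (\sum_(i < m) q i + 1)))).
  by apply: ler_sum => i _; rewrite ler_wpM2l// NP// leq_bigmax.
by rewrite -mulr_suml mulrA ler_pdivrMr// mulrC ler_wpM2l ?(ltW e0)// lerDl.
Qed.

Lemma compact_lambda0 T : adjointable T -> compact_op T -> lambda0 T = 0.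
Proof.
move=> hT Tc; apply/eqP; rewrite eq_le lambda0_ge0 andbT.
apply: epsilon_le => e e0; rewrite add0r.
have e2 : 0 < e / 2 by rewrite divr_gt0.
have [F Ffin TF] := Tc _ e2; have [k Fk kF] := finite_rank_tail Ffin.
have [n kn] := kF _ e2.
have TFle x : l2ball x -> l2norm (T x - F x) <= e / 2.
  move=> xB; apply: le_trans (ltW TF).
  apply: (@opnorm_ge _ _ (T - F) (opnorm T + k 0)) xB => u uB.
  have [Fu2 Fu] := Fk 0 _ uB; have Tu2 := adjointable_l2 hT uB.1.
  apply: (le_trans (ler_l2normB Tu2 Fu2)).
  by rewrite lerD ?l2norm_opnorm_ball// -[F u]l2tail0.
apply: (@lambda0_le _ _ T n); first exact: ltW.
move=> x xB; have [Fx2 Fx] := Fk n _ xB; have Tx2 := adjointable_l2 hT xB.1.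
have TF2 := l2B Tx2 Fx2.
rewrite -[T x](subrK (F x)) l2tailD.
apply: (le_trans (ler_l2normD (l2_tail _ TF2) (l2_tail _ Fx2))).
have : l2norm (l2tail n (T x - F x)) <= l2norm (T x - F x).
  apply: (proj2 (l2_dominated1 _ TF2)) => j h; rewrite /l2tail.
  by case: ifP => // _; rewrite rnorm0 rnorm_ge0.
have := TFle _ xB; have := le_trans Fx kn; lra.
Qed.

(** The truncation of [T x] to its first coordinates is the finite rank
    operator built from the coordinate vectors and their images under the
    adjoint. *)
Lemma compact_of_tails T S : adjointable T -> l2_adjoint T S ->
  (forall e : R, 0 < e ->
    exists n, forall x, l2ball x -> l2norm (l2tail n (T x)) <= e) ->
  compact_op T.
Proof.
move=> hT [S2 TS] tails e e0; have e2 : 0 < e / 2 by rewrite divr_gt0.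
have [n hn] := tails _ e2.
pose b (i : 'I_n) : nat -> A := fun j => if j == i then 1 else 0.
have b0 (i : 'I_n) j : (i < j)%N -> b i j = 0 by move=> ij; rewrite /b gtn_eqF.
have b2 i : l2 (b i) by apply: (@l2_finite _ _ i.+1) => j; exact: b0.
pose F : (nat -> A) -> nat -> A := \sum_(i < n) (1 : R[i]) *: rank_one (b i) (S (b i)).
have FE x : l2 x -> F x = l2trunc n (T x).
  move=> x2; have Tx2 := adjointable_l2 hT x2; rewrite /F fct_sumE.
  have term i : ((1 : R[i]) *: rank_one (b i) (S (b i))) x = rscale (b i) (T x i).
    rewrite scale1r /rank_one; congr rscale.
    rewrite (l2dotC x2 (S2 _ (b2 i))) -TS// (@l2dot_finite _ _ i.+1); last exact: b0.
    rewrite big_nat_recr//= big_nat big1 ?add0r => [|j /= ji].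
      by rewrite /b eqxx mulr1 bop_adjK.
    by rewrite /b ltn_eqF// mulr0.
  under eq_bigr do rewrite term.
  apply/funext => j; rewrite fct_sumE /l2trunc /rscale.
  have [jn|nj] := ltnP j n.
    rewrite (bigD1 (Ordinal jn))//= /b eqxx mul1r big1 ?addr0// => i ij.
    by rewrite ifN ?mul0r//; apply: contra_neqN ij => /eqP ji; exact/val_inj.
  by rewrite big1// => i _; rewrite b0 ?mul0r// (leq_trans (ltn_ord i)).
exists F.
  by exists n, (fun=> 1), b, (fun i => S (b i)); split=> // i; split=> //; exact: S2.
apply: (@le_lt_trans _ _ (e / 2)); last by rewrite ltr_pdivrMr// ltr_pMr// ltr1n.
apply: opnorm_le => x xB; apply: le_trans (hn _ xB).
rewrite (_ : (T - F) x = l2tail n (T x))//.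
have -> : (T - F) x = T x - F x by [].
by rewrite (FE _ xB.1) {1}(l2trunc_tail n (T x)) addrAC subrr add0r.
Qed.

Section Estimates.
Variables T S : (nat -> A) -> nat -> A.
Hypotheses (hT : adjointable T) (hS : l2_adjoint T S).

(** The loss [d] in the separation is arbitrary. *)
Lemma tails_le_istratescu (c : R) : 0 <= c ->
  (forall n, exists2 x, l2ball x & c < l2norm (l2tail n (T x))) ->
  c ^+ 2 <= opnorm T * star0 istratescu T.
Proof.
move=> c0 tails; have I0 : 0 <= star0 istratescu T by exact: star_istratescu_ge0.
have [t_eq0|t_neq0] := eqVneq (opnorm T) 0.
  have [x xB] := tails 0; rewrite l2tail0 ltNge.
  by move: (l2norm_opnorm_ball hT xB); rewrite t_eq0 => /le_trans -> //.
have t0 : 0 < opnorm T by rewrite lt_def t_neq0 opnorm_ge0.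
rewrite mulrC -ler_pdivrMr//; apply: epsilon_le => d d0.
have [cd|cd] := leP (c ^+ 2 / opnorm T) d; first by rewrite (le_trans cd)// lerDr.
move: cd; rewrite -subr_gt0 => cd.
have [p pP pI] := separated_sequence hT hS c0 d0 cd tails.
rewrite -lerBlDr; apply: (le_trans pI).
apply: (@star_istratescu_ge _ _ _ (opnorm T)) pP; last exact: opnorm_ge0.
- by move=> _ [x [x2 _] <-]; exact: (adjointable_l2 hT).
- by move=> _ [x xB <-]; exact: l2norm_opnorm_ball.
Qed.

Lemma tails_dichotomy (c : R) :
  (exists n, forall x, l2ball x -> l2norm (l2tail n (T x)) <= c) \/
  (forall n, exists2 x, l2ball x & c < l2norm (l2tail n (T x))).
Proof.
have [|none] := pselect (exists n, forall x, l2ball x -> l2norm (l2tail n (T x)) <= c).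
  by left.
right=> n; apply: contrapT => nx; apply: none; exists n => x xB.
by rewrite leNgt; apply/negP => lt; apply: nx; exists x.
Qed.

Lemma lambda0_le_istratescu :
  lambda0 T <= Num.sqrt (opnorm T * star0 istratescu T).
Proof.
set s := Num.sqrt _; rewrite leNgt; apply/negP => sl.
have s0 : 0 <= s by exact: sqrtr_ge0.
(* Any number strictly between [s] and [lambda0 T] does. *)
pose c := (s + lambda0 T) / 2.
have c0 : 0 <= c by rewrite divr_ge0// addr_ge0// lambda0_ge0.
have [[n hn]|tails] := tails_dichotomy c.
  by have := lambda0_le c0 hn; rewrite /c; lra.
have := tails_le_istratescu c0 tails.
move=> /(@ler_wsqrtr R); rewrite sqrtr_sqr ger0_norm// -/s /c; lra.
Qed.

Lemma hausdorff_le_lambda0 : star0 hausdorff T <= lambda0 T.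
Proof.
have E2 : T @` l2ball `<=` l2 by move=> _ [x [x2 _] <-]; exact: (adjointable_l2 hT).
have EK x : (T @` l2ball) x -> l2norm x <= opnorm T.
  by move=> [u uB <-]; exact: l2norm_opnorm_ball.
apply: lb_le_inf.
  exists (opnorm T + 1); split; first by rewrite ltr_wpDl// opnorm_ge0.
  exists (trunc_module 0); first exact: trunc_module_free.
  apply: (@le_lt_trans _ _ (opnorm T)); last by rewrite ltrDl.
  apply: near_lambda_set => x xB; exists 0 => //; rewrite subr0.
  exact: l2norm_opnorm_ball.
move=> e [e0 [M Mfree Msup]]; apply: star_le => [|p pP]; first exact: ltW.
apply: (hausdorff_le_near_free E2 EK (opnorm_ge0 T) Mfree pP e0).
move=> _ [x xB <-]; apply: (lambda_set_near Mfree _ Msup xB) => u uB.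
by split; [exact: (adjointable_l2 hT uB.1)|exact: l2norm_opnorm_ball].
Qed.

End Estimates.

End Compactness.

Theorem proposition4p7 (R : realType) (H : hilbertType R)
    (T : (nat -> bop H) -> nat -> bop H) (hT : adjointable T) :
  [/\ star0 hausdorff T <= lambda0 T,
      lambda0 T <= Num.sqrt (opnorm T * star0 istratescu T),
      Num.sqrt (opnorm T * star0 istratescu T)
        <= Num.sqrt (opnorm T * star0 kuratowski T) &
      Num.sqrt (opnorm T * star0 kuratowski T)
        <= Num.sqrt (2 * opnorm T * star0 hausdorff T)] /\
  (forall mu, [\/ mu = kuratowski, mu = hausdorff | mu = istratescu] ->
    (star0 mu T = 0 <-> lambda0 T = 0) /\
    (lambda0 T = 0 <-> compact_op T)).
Proof.
have [_ _ _ _ [S hS]] := hT.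
have E2 : T @` l2ball `<=` l2 by move=> _ [x [x2 _] <-]; exact: (adjointable_l2 hT).
have EK x : (T @` l2ball) x -> l2norm x <= opnorm T.
  by move=> [u uB <-]; exact: l2norm_opnorm_ball.
have T0 := opnorm_ge0 T.
have chi_lambda := hausdorff_le_lambda0 hT.
have lambda_I := lambda0_le_istratescu hT hS.
have I_alpha : star0 istratescu T <= star0 kuratowski T.
  exact: star_istratescu_le_kuratowski EK T0.
have alpha_chi : star0 kuratowski T <= 2 * star0 hausdorff T.
  exact: star_kuratowski_le_hausdorff EK T0.
have I0 : 0 <= star0 istratescu T by exact: star_istratescu_ge0.
have lambda_ge0 := lambda0_ge0 T.
split.
  split=> //; apply: ler_wsqrtr; first exact: ler_wpM2l.
  by rewrite -mulrA mulrCA ler_wpM2l.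
have I_lambda : star0 istratescu T = 0 -> lambda0 T = 0.
  by move=> I_eq0; apply/eqP; rewrite eq_le lambda_ge0 andbT;
    move: lambda_I; rewrite I_eq0 mulr0 sqrtr0.
have chi0 : 0 <= star0 hausdorff T by exact: star_hausdorff_ge0 EK T0.
have lambda_chi : lambda0 T = 0 -> star0 hausdorff T = 0 by lra.
have lambda_alpha : lambda0 T = 0 -> star0 kuratowski T = 0 by lra.
have lambda_I0 : lambda0 T = 0 -> star0 istratescu T = 0 by lra.
move=> mu muE; split.
  case: muE => ->; split=> // mu_eq0; apply: I_lambda; lra.
split; last exact: compact_lambda0.
move=> /lambda_I0 I_eq0; apply: (compact_of_tails hT hS) => e e0.
have [//|tails] := tails_dichotomy T e.
have := tails_le_istratescu hT hS (ltW e0) tails.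
by rewrite I_eq0 mulr0 leNgt exprn_gt0.
Qed.
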